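(* Let $\Omega\subset\mathbb{C}^d$ be a domain and let $X=X(\Omega)$ be a topological vector space consisting of holomorphic functions on $\Omega$, whose topology is induced by a complete metric and such that convergence in $X$ implies uniform convergence on compact subsets of $\Omega$. Let $T$ be the identity or an operator of mixed partial derivation. Assume that for every ball $B(\zeta,\varepsilon)\subset\mathbb{C}^d$ with radius $\varepsilon>0$ centered at $\zeta\in\partial\Omega$ and for every connected component $Y$ of $\Omega\cap B(\zeta,\varepsilon)$ there exists a function $h_Y$ in $X$ such that the restriction $Th_Y|_Y$ is unbounded. Then there exists a function $h\in X$ such that $Th$ is totally unbounded on $\Omega$; the set of $f\in X$ such that $Tf$ is totally unbounded on $\Omega$ is a dense and $G_\delta$ subset of $X$; and the set of non-extendable functions in $X$ is a dense and $G_\delta$ subset of $X$.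
   Context: A domain is a nonempty connected open set. The vector space operations on $X$ are the usual pointwise addition and scalar multiplication. An operator of mixed partial derivation is an operator $\partial^{|k|}/\partial z_1^{k_1}\cdots\partial z_d^{k_d}$ acting on holomorphic functions on $\Omega$, where $k_1,\dots,k_d$ are nonnegative integers and $|k|=k_1+\cdots+k_d$. $B(\zeta,\varepsilon)$ is the open Euclidean ball in $\mathbb{C}^d$. A function $g:\Omega\to\mathbb{C}$ is called totally unbounded on $\Omega$ if for every ball $B(\zeta,\varepsilon)\subset\mathbb{C}^d$ with $\varepsilon>0$ and $\zeta\in\partial\Omega$ and every connected component $Y$ of $B(\zeta,\varepsilon)\cap\Omega$ the restriction $g|_Y$ is unbounded. A holomorphic function $f$ on $\Omega$ is called extendable if there exist a domain $U\subset\mathbb{C}^d$ with $\partial\Omega\cap U\neq\emptyset$ and a holomorphic function $F$ on $U$ such that $f|_Y=F|_Y$ for some connected component $Y$ of $U\cap\Omega$. Otherwise $f$ is called non-extendable. *)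

(* Defs.v *)
From HB Require Import structures.
From mathcomp Require Import all_boot all_order all_algebra.
From mathcomp Require Import complex.
From mathcomp Require Import all_classical all_reals all_analysis borel_hierarchy.

Set Implicit Arguments.
Unset Strict Implicit.
Unset Printing Implicit Defensive.

Import Order.TTheory GRing.Theory Num.Theory.
Import numFieldNormedType.Exports.

Local Open Scope classical_set_scope.
Local Open Scope ring_scope.
Local Open Scope complex_scope.

(* The complex numbers, as a field rather than as the bare type R[i]: on R[i] the
   library has the scalar action of R, on Cplx R the one of Cplx R itself.  So
   'rV[Cplx R]_d is a normed module over Cplx R (for the sup norm, whose topology
   is the Euclidean one), and [differentiable] and ['D_v] are the complex
   notions. *)
Definition Cplx (R : realType) : numClosedFieldType := R[i].

Section several_complex_variables.
Variables (R : realType) (d : nat).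
Local Notation C := (Cplx R).
Local Notation Cd := 'rV[Cplx R]_d.
Implicit Types (A Y U Omega : set Cd) (zeta : Cd) (f g F : Cd -> C).

Definition domain U := [/\ open U, connected U & U !=set0].

Definition boundary A : set Cd := closure A `\` interior A.

(* The Euclidean norm, as a nonnegative real element of C. *)
Definition enorm (z : Cd) : C := sqrtC (\sum_(i < d) `|z 0 i| ^+ 2).

Definition eball zeta (eps : R) : set Cd :=
  [set z | enorm (z - zeta) < eps%:C].

(* [connected_component A x] is empty for x outside A, hence the guard: the
   components of A are nonempty. *)
Definition component_of A Y := exists2 x, A x & Y = connected_component A x.

(* Functions on a subset of C^d are total functions on C^d of which only the
   values on that subset matter. *)
Definition holomorphic_on U f := forall z, U z -> differentiable f z.

Definition unbounded_on Y g := ~ [bounded g z | z in Y].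

Definition totally_unbounded Omega g :=
  forall zeta (eps : R) Y, boundary Omega zeta -> 0 < eps ->
    component_of (eball zeta eps `&` Omega) Y -> unbounded_on Y g.

Definition extendable Omega f :=
  exists U F Y, [/\ domain U, boundary Omega `&` U !=set0, holomorphic_on U F,
    component_of (U `&` Omega) Y & {in Y, f =1 F}].

Definition mixed_partial (k : 'I_d -> nat) f : Cd -> C :=
  foldr (fun i g => iter (k i) (fun h : Cd -> C => 'D_(delta_mx 0 i) h) g)
    f (enum 'I_d).

Definition id_or_mixed_partial (T : (Cd -> C) -> (Cd -> C)) :=
  T = id \/ exists k : 'I_d -> nat, T = mixed_partial k.

(* A topological vector space X of holomorphic functions on Omega: the element
   f of X is the function [ev f] restricted to Omega.  Thus elements with the
   same restriction are equal, and the operations of X are the pointwise ones;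
   values of [ev f] outside Omega are irrelevant. *)
Record holomorphic_function_space Omega (X : topologicalLmodType C)
    (ev : X -> Cd -> C) : Prop := {
  ev_holomorphic : forall f : X, holomorphic_on Omega (ev f) ;
  ev_inj : forall f g : X, {in Omega, ev f =1 ev g} -> f = g ;
  evD : forall f g : X, {in Omega, forall z, ev (f + g) z = ev f z + ev g z} ;
  evZ : forall (a : C) (f : X), {in Omega, forall z, ev (a *: f) z = a * ev f z}
}.

Definition cvg_uniform_on_compacts Omega (X : topologicalLmodType C)
    (ev : X -> Cd -> C) :=
  forall (u : nat -> X) (f : X), u @ \oo --> f ->
    forall K : set Cd, compact K -> K `<=` Omega ->
      {uniform K, (fun n => ev (u n)) @ \oo --> ev f}.

End several_complex_variables.

Section complete_metric.
Variables (R : realType) (X : topologicalType) (dist : X -> X -> R).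

Record is_metric : Prop := {
  dist_ge0 : forall x y, 0 <= dist x y ;
  dist_eq0 : forall x y, dist x y = 0 <-> x = y ;
  distC : forall x y, dist x y = dist y x ;
  dist_triangle : forall x y z, dist x z <= dist x y + dist y z
}.

Definition induces_topology := forall (x : X) (A : set X),
  nbhs x A <-> exists2 e : R, 0 < e & [set y | dist x y < e] `<=` A.

Definition dist_cauchy (u : nat -> X) := forall e : R, 0 < e ->
  exists N, forall m n, (N <= m)%N -> (N <= n)%N -> dist (u m) (u n) < e.

Definition dist_complete := forall u : nat -> X, dist_cauchy u ->
  exists l : X, forall e : R, 0 < e ->
    exists N, forall n, (N <= n)%N -> dist (u n) l < e.

End complete_metric.

(* The metric need not be translation invariant. *)
Definition completely_metrizable (R : realType) (X : topologicalType) :=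
  exists dist : X -> X -> R,
    [/\ is_metric dist, induces_topology dist & dist_complete dist].

(* Main.v *)
(* Total unboundedness and non-extendability need only be tested on countably many
   cells: components Y of V /\ Omega, for V a polydisc with rational center and
   radius that is not contained in Omega, since such a Y always accumulates at a
   point of the boundary of Omega inside V.

   For a fixed cell and n the set {f : |T f| > n somewhere on Y} is open because
   f |-> T f z is continuous, and dense because T (f + t h) = T f + t T h is
   unbounded on Y for small t <> 0 as soon as T f is bounded and T h unbounded
   there. Baire's theorem then gives the statements on total unboundedness. If T f
   is totally unbounded then f is not extendable: an extension F would make T F,
   which is holomorphic, locally bounded at a boundary point of Omega. Finally the
   set of f having on V an extension bounded by n is closed, so the non-extendable
   functions form a G_delta.

   The complex analysis rests on one uniform estimate for a holomorphic function
   bounded by M on a polydisc of radius comparable to s,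
     |F (z + h) - F z - D_h F z| <= 16 M (|h| / s)^2,
   obtained on complex lines from Goursat's theorem and the Cauchy formula for
   squares. It passes to pointwise limits along any filter, hence bounded pointwise
   limits of holomorphic functions are holomorphic and their derivatives converge.
   This yields the holomorphy of partial derivatives (limits of difference
   quotients), the continuity of f |-> T f z, and the closedness above (limits
   along an ultrafilter). *)
From HB Require Import structures.
Require Import Defs.
From mathcomp Require Import all_boot all_order all_algebra.
From mathcomp Require Import complex.
From mathcomp Require Import all_classical all_reals all_analysis borel_hierarchy.
From mathcomp Require Import ring lra.

Set Implicit Arguments.
Unset Strict Implicit.
Unset Printing Implicit Defensive.

Import Order.TTheory GRing.Theory Num.Theory.
Import numFieldNormedType.Exports.

Local Open Scope classical_set_scope.
Local Open Scope ring_scope.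
Local Open Scope complex_scope.

(** * Complex modulus and integrals *)

(** The library norm on [Cplx R] takes values in [Cplx R], which is only partially ordered; this
    real copy is the one on which [lra] and [nra] can work. *)
HB.lock Definition normc (R : realType) (z : Cplx R) : R := complex.Re `|z|.

Section complex_modulus.
Variable R : realType.
Local Notation C := (Cplx R).
Implicit Types z w : C.

Lemma normc_def z : `|z| = (normc z)%:C.
Proof. by rewrite normc.unlock; case: z. Qed.

Lemma normc_cplx (a b : R) : normc (a +i* b : C) = Num.sqrt (a ^+ 2 + b ^+ 2).
Proof. by rewrite normc.unlock. Qed.

Lemma normc_ge0 z : 0 <= normc z.
Proof. by case: z => a b; rewrite normc_cplx sqrtr_ge0. Qed.

Lemma normcM z w : normc (z * w) = normc z * normc w.
Proof. by apply: complexI; rewrite rmorphM /= -!normc_def normrM. Qed.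

Lemma normcV z : normc z^-1 = (normc z)^-1.
Proof. by apply: complexI; rewrite fmorphV /= -!normc_def normfV. Qed.

Lemma normcX z n : normc (z ^+ n) = normc z ^+ n.
Proof. by apply: complexI; rewrite rmorphXn /= -!normc_def normrX. Qed.

Lemma normcN z : normc (- z) = normc z.
Proof. by rewrite normc.unlock normrN. Qed.

Lemma normcB z w : normc (z - w) = normc (w - z).
Proof. by rewrite -normcN opprB. Qed.

Lemma normcD z w : normc (z + w) <= normc z + normc w.
Proof. by rewrite -lecR rmorphD /= -!normc_def; exact: ler_normD. Qed.

Lemma normc0 : normc (0 : C) = 0.
Proof. by rewrite normc.unlock normr0. Qed.

Lemma normc_real (a : R) : normc a%:C = `|a|.
Proof. by rewrite normc_cplx expr0n addr0 sqrtr_sqr. Qed.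

Lemma normc_eq0 z : (normc z == 0) = (z == 0).
Proof. by rewrite -(inj_eq (@complexI R)) -normc_def rmorph0 normr_eq0. Qed.

Lemma normc_gt0 z : (0 < normc z) = (z != 0).
Proof. by rewrite lt_def normc_ge0 andbT normc_eq0. Qed.

Lemma normc_i : normc ('i%C : C) = 1.
Proof. by rewrite normc_cplx expr0n add0r expr1n sqrtr1. Qed.

Lemma Re_le_normc z : `|complex.Re z| <= normc z.
Proof.
case: z => a b /=; rewrite normc_cplx -sqrtr_sqr ler_wsqrtr//.
by rewrite lerDl sqr_ge0.
Qed.

Lemma Im_le_normc z : `|complex.Im z| <= normc z.
Proof.
case: z => a b /=; rewrite normc_cplx -sqrtr_sqr ler_wsqrtr//.
by rewrite lerDr sqr_ge0.
Qed.

Lemma normc_le_ReIm z : normc z <= `|complex.Re z| + `|complex.Im z|.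
Proof.
have -> : z = (complex.Re z)%:C + 'i%C * (complex.Im z)%:C by exact: complexE.
rewrite (le_trans (normcD _ _))// normcM normc_i mul1r !normc_real /=.
by rewrite ?(mul0r, mulr0, subr0, addr0, add0r, mul1r).
Qed.

Lemma nbhs_normc z (A : set C) :
  nbhs z A <-> exists2 e : R, 0 < e & [set w | normc (z - w) < e] `<=` A.
Proof.
rewrite -nbhs_ballE; split=> [[e e0 eA]|[e e0 eA]].
  (* Balls have complex radii here; a positive one is real, so it can be replaced by its real
     part. *)
  have er : e \is Num.real by exact: gtr0_real.
  exists (complex.Re e) => [|w /= zw]; first by rewrite -ltcR RRe_real.
  by apply: eA; rewrite /ball /= normc_def -(RRe_real er) ltcR.
exists e%:C => [|w]; first by rewrite /= ltcR.
by rewrite /ball /= normc_def ltcR => zw; exact: eA.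
Qed.

Lemma cvgcP (T : Type) (F : set_system T) {FF : Filter F} (f : T -> C) (l : C) :
  f @ F --> l <-> forall e : R, 0 < e -> \forall x \near F, normc (l - f x) < e.
Proof.
split=> [fl e e0|fl A /nbhs_normc[e e0 eA]].
  by apply: (fl [set w | normc (l - w) < e]); apply/nbhs_normc; exists e.
by apply: (filterS _ (fl _ e0)) => x; exact: eA.
Qed.

Lemma continuous_Re : continuous (@complex.Re R : C -> R).
Proof.
move=> z; apply/(cvgrPdist_lt (F := nbhs z)) => e e0.
apply/nbhs_normc; exists e => // w /= zw.
apply: le_lt_trans zw; rewrite (le_trans _ (Re_le_normc _))//.
by case: (z) (w) => [a b] [c d].
Qed.

Lemma continuous_Im : continuous (@complex.Im R : C -> R).
Proof.
move=> z; apply/(cvgrPdist_lt (F := nbhs z)) => e e0.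
apply/nbhs_normc; exists e => // w /= zw.
apply: le_lt_trans zw; rewrite (le_trans _ (Im_le_normc _))//.
by case: (z) (w) => [a b] [c d].
Qed.

Lemma cvg_cplx (T : Type) (F : set_system T) {FF : Filter F} (f g : T -> R) a b :
  f @ F --> a -> g @ F --> b -> (f x +i* g x : C) @[x --> F] --> (a +i* b : C).
Proof.
move=> /cvgrPdist_lt fa /cvgrPdist_lt gb; apply/cvgcP => e e0.
have e2 : 0 < e / 2 by rewrite divr_gt0.
have := fa _ e2; have := gb _ e2; apply: filterS2 => x gx fx.
by rewrite (le_lt_trans (normc_le_ReIm _))//= (splitr e) ltrD.
Qed.

End complex_modulus.

(** * Integrals of complex-valued functions over real segments *)

HB.lock Definition cint (R : realType) (g : R -> Cplx R) (a b : R) : Cplx R :=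
  (\int[@lebesgue_measure R]_(x in `[a, b]) complex.Re (g x)) +i*
  (\int[@lebesgue_measure R]_(x in `[a, b]) complex.Im (g x)).

Section complex_integral.
Variable R : realType.
Local Notation C := (Cplx R).
Local Notation mu := (@lebesgue_measure R).
Implicit Types (g h : R -> C) (a b m : R).

(** Continuity is two-sided even at the end points, so it passes to subsegments and compositions
    without subspace topologies. *)
Definition continuous_over (T : topologicalType) (g : R -> T) a b :=
  forall x, a <= x <= b -> {for x, continuous g}.

Lemma continuous_overS (T : topologicalType) (g : R -> T) a b a' b' :
  a <= a' -> b' <= b -> continuous_over g a b -> continuous_over g a' b'.
Proof.
move=> aa bb cg x /andP[ax xb]; apply: cg.
by rewrite (le_trans aa ax) (le_trans xb bb).
Qed.

Lemma continuous_over_integrable (f : R -> R) a b :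
  continuous_over f a b -> mu.-integrable `[a, b] (EFin \o f).
Proof.
move=> cf; apply: continuous_compact_integrable; first exact: segment_compact.
apply: continuous_in_subspaceT => x; rewrite inE /= in_itv /= => xab.
exact: cf.
Qed.

Lemma continuous_over_Re g a b :
  continuous_over g a b -> continuous_over (fun x => complex.Re (g x)) a b.
Proof.
move=> cg x xab; apply: (@continuous_comp _ _ _ g (@complex.Re R : C -> R)).
  exact: cg.
exact: continuous_Re.
Qed.

Lemma continuous_over_Im g a b :
  continuous_over g a b -> continuous_over (fun x => complex.Im (g x)) a b.
Proof.
move=> cg x xab; apply: (@continuous_comp _ _ _ g (@complex.Im R : C -> R)).
  exact: cg.
exact: continuous_Im.
Qed.

Lemma eq_cint g h a b : (forall x, a <= x <= b -> g x = h x) ->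
  cint g a b = cint h a b.
Proof.
move=> gh; rewrite cint.unlock; congr (_ +i* _); apply: eq_Rintegral => x;
  by rewrite inE /= in_itv /= => /gh ->.
Qed.

Let ReD (z w : C) : complex.Re (z + w) = complex.Re z + complex.Re w.
Proof. by case: z w => ? ? []. Qed.
Let ImD (z w : C) : complex.Im (z + w) = complex.Im z + complex.Im w.
Proof. by case: z w => ? ? []. Qed.
Let ReM (z w : C) :
  complex.Re (z * w) = complex.Re z * complex.Re w - complex.Im z * complex.Im w.
Proof. by case: z w => ? ? []. Qed.
Let ImM (z w : C) :
  complex.Im (z * w) = complex.Re z * complex.Im w + complex.Im z * complex.Re w.
Proof. by case: z w => ? ? []. Qed.

Lemma cintD g h a b : continuous_over g a b -> continuous_over h a b ->
  cint (fun x => g x + h x) a b = cint g a b + cint h a b.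
Proof.
move=> cg ch; rewrite cint.unlock.
have ig := continuous_over_integrable (continuous_over_Re cg).
have ig' := continuous_over_integrable (continuous_over_Im cg).
have ih := continuous_over_integrable (continuous_over_Re ch).
have ih' := continuous_over_integrable (continuous_over_Im ch).
under eq_Rintegral do rewrite ReD.
under [X in _ +i* X = _]eq_Rintegral do rewrite ImD.
by rewrite (RintegralD (mu := mu) (measurable_itv _) ig' ih')
  (RintegralD (mu := mu) (measurable_itv _) ig ih).
Qed.

Lemma cintZ (c : C) g a b : continuous_over g a b ->
  cint (fun x => c * g x) a b = c * cint g a b.
Proof.
move=> cg; rewrite cint.unlock.
have cR := continuous_over_Re cg; have cI := continuous_over_Im cg.
have ig := continuous_over_integrable cR.
have ig' := continuous_over_integrable cI.
have iz (f : R -> R) k : continuous_over f a b ->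
    mu.-integrable `[a, b] (EFin \o (fun x => k * f x)).
  move=> cf; apply: continuous_over_integrable => x xab.
  by apply: cvgM; [exact: cvg_cst|exact: cf].
under eq_Rintegral do rewrite ReM.
under [X in _ +i* X = _]eq_Rintegral do rewrite ImM.
rewrite (RintegralB (mu := mu) (measurable_itv _) (iz _ _ cR) (iz _ _ cI)).
rewrite (RintegralD (mu := mu) (measurable_itv _) (iz _ _ cI) (iz _ _ cR)).
rewrite !(RintegralZl (mu := mu) _ (measurable_itv _) ig).
rewrite !(RintegralZl (mu := mu) _ (measurable_itv _) ig').
by case: (c).
Qed.

Lemma cint_split m g a b : a <= m <= b -> continuous_over g a b ->
  cint g a b = cint g a m + cint g m b.
Proof.
move=> /andP[am mb] cg.
have H (f : R -> R) : continuous_over f a b ->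
    \int[mu]_(x in `[a, b]) f x =
    \int[mu]_(x in `[a, m]) f x + \int[mu]_(x in `[m, b]) f x.
  move=> /continuous_over_integrable fi.
  have := @Rintegral_itvB R f (BLeft a) (BRight b) m fi.
  rewrite !bnd_simp => /(_ am mb) /eqP; rewrite subr_eq addrC => /eqP ->.
  (* The second piece comes without its end point [m], which has measure zero. *)
  congr (_ + _); apply: Rintegral_itv_obnd_cbnd.
  apply: integrableS fi => //.
  by apply: subset_itv; rewrite ?bnd_simp.
rewrite cint.unlock (H _ (continuous_over_Re cg)) (H _ (continuous_over_Im cg)).
by [].
Qed.

Let fine_mu_itv a b : a <= b -> fine (mu `[a, b]) = b - a.
Proof.
move=> ab; have -> := lebesgue_measure_itv `[a, b]; rewrite /= lte_fin.
by case: ltP => //= ba; apply/esym/eqP; rewrite subr_eq0 eq_le ab ba.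
Qed.

Lemma cint_cst (c : C) a b : a <= b -> cint (fun=> c) a b = c * (b - a)%:C.
Proof.
move=> ab; rewrite cint.unlock !(Rintegral_cst mu (measurable_itv _)).
rewrite fine_mu_itv//.
by case: c => x y; apply/eqP; rewrite eq_complex /= !mulr0 subr0 add0r !eqxx.
Qed.

(* The factor 2 comes from bounding the two components separately. *)
Lemma cint_bound g a b (M : R) : a <= b -> continuous_over g a b ->
  (forall x, a <= x <= b -> normc (g x) <= M) ->
  normc (cint g a b) <= 2 * M * (b - a).
Proof.
move=> ab cg gM.
have H (f : R -> R) : continuous_over f a b ->
    (forall x, a <= x <= b -> `|f x| <= M) ->
    `|\int[mu]_(x in `[a, b]) f x| <= M * (b - a).
  move=> cf fM; have fi := continuous_over_integrable cf.
  apply: (le_trans (le_normr_Rintegral (mu := mu) (measurable_itv _) fi)).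
  have -> : M * (b - a) = \int[mu]_(x in `[a, b]) M.
    by rewrite (Rintegral_cst mu (measurable_itv _)) fine_mu_itv.
  apply: le_Rintegral => //.
    apply: continuous_over_integrable => x xab.
    by apply: cvg_norm; exact: cf.
  by apply: continuous_over_integrable => x _; exact: cvg_cst.
rewrite cint.unlock; apply: (le_trans (normc_le_ReIm _)) => /=.
rewrite -mulrA mulr_natl mulr2n lerD// H//.
- exact: continuous_over_Re.
- by move=> x xab; rewrite (le_trans (Re_le_normc _))// gM.
- exact: continuous_over_Im.
- by move=> x xab; rewrite (le_trans (Im_le_normc _))// gM.
Qed.

End complex_integral.

(* The integral over the boundary of [a, b] x [c, d], run counterclockwise. *)
HB.lock Definition rint (R : realType) (f : Cplx R -> Cplx R) (a b c d : R) :
    Cplx R :=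
  cint (fun x => f (x +i* c) - f (x +i* d)) a b +
  'i%C * cint (fun y => f (b +i* y) - f (a +i* y)) c d.

(** * Integrals over boundaries of rectangles *)

Section rectangle_integral.
Variable R : realType.
Local Notation C := (Cplx R).
Implicit Types (f g : C -> C) (a b c d m : R) (z w : C).

(** Only the four sides are concerned, since the integrands of the Cauchy formula have poles inside
    the rectangle. *)
Definition edge_continuous f a b c d :=
  [/\ continuous_over (fun x => f (x +i* c)) a b,
      continuous_over (fun x => f (x +i* d)) a b,
      continuous_over (fun y => f (a +i* y)) c d &
      continuous_over (fun y => f (b +i* y)) c d].

Lemma continuous_over_horizontal f y a b :
  (forall x, a <= x <= b -> {for (x +i* y : C), continuous f}) ->
  continuous_over (fun x => f (x +i* y)) a b.
Proof.
move=> cf x xab; apply: (@continuous_comp _ _ _ (fun x => x +i* y : C) f).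
  by apply: (cvg_cplx (F := nbhs x)); [exact: cvg_id|exact: cvg_cst].
exact: cf.
Qed.

Lemma continuous_over_vertical f x c d :
  (forall y, c <= y <= d -> {for (x +i* y : C), continuous f}) ->
  continuous_over (fun y => f (x +i* y)) c d.
Proof.
move=> cf y ycd; apply: (@continuous_comp _ _ _ (fun y => x +i* y : C) f).
  by apply: (cvg_cplx (F := nbhs y)); [exact: cvg_cst|exact: cvg_id].
exact: cf.
Qed.

Lemma continuous_overB (g h : R -> C) a b : continuous_over g a b ->
  continuous_over h a b -> continuous_over (fun x => g x - h x) a b.
Proof. by move=> cg ch x xab; apply: cvgB; [exact: cg|exact: ch]. Qed.

Lemma rintD f g a b c d : edge_continuous f a b c d ->
  edge_continuous g a b c d ->
  rint (fun z => f z + g z) a b c d = rint f a b c d + rint g a b c d.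
Proof.
move=> [f1 f2 f3 f4] [g1 g2 g3 g4]; rewrite rint.unlock addrACA -mulrDr.
rewrite -!cintD; try exact: continuous_overB.
by congr (_ + 'i%C * _); apply: eq_cint => x _; ring.
Qed.

Lemma rintZ (k : C) f a b c d : edge_continuous f a b c d ->
  rint (fun z => k * f z) a b c d = k * rint f a b c d.
Proof.
move=> [f1 f2 f3 f4]; rewrite rint.unlock mulrDr mulrCA.
rewrite -(cintZ k (continuous_overB f1 f2)) -(cintZ k (continuous_overB f4 f3)).
by congr (_ + 'i%C * _); apply: eq_cint => x _; ring.
Qed.

Lemma eq_rint f g a b c d : a <= b -> c <= d ->
  (forall x, a <= x <= b -> f (x +i* c) = g (x +i* c)) ->
  (forall x, a <= x <= b -> f (x +i* d) = g (x +i* d)) ->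
  (forall y, c <= y <= d -> f (a +i* y) = g (a +i* y)) ->
  (forall y, c <= y <= d -> f (b +i* y) = g (b +i* y)) ->
  rint f a b c d = rint g a b c d.
Proof.
move=> ab cd h1 h2 h3 h4; rewrite rint.unlock.
congr (_ + 'i%C * _); apply: eq_cint => x xab.
  by rewrite h1// h2.
by rewrite h3// h4.
Qed.

(** The two pieces run through their common side at [m] in opposite directions, so its contributions
    cancel. *)
Lemma rint_splitx m f a b c d : a <= m <= b -> edge_continuous f a b c d ->
  continuous_over (fun y => f (m +i* y)) c d ->
  rint f a b c d = rint f a m c d + rint f m b c d.
Proof.
move=> amb [f1 f2 f3 f4] fm; rewrite rint.unlock (cint_split amb); last first.
  exact: continuous_overB.
rewrite addrACA -mulrDr -cintD; try exact: continuous_overB.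
by congr (_ + 'i%C * _); apply: eq_cint => x _; ring.
Qed.

Lemma rint_splity m f a b c d : c <= m <= d -> edge_continuous f a b c d ->
  continuous_over (fun x => f (x +i* m)) a b ->
  rint f a b c d = rint f a b c m + rint f a b m d.
Proof.
move=> cmd [f1 f2 f3 f4] fm.
rewrite rint.unlock [X in 'i%C * X](cint_split cmd); last first.
  exact: continuous_overB.
rewrite mulrDr addrACA -cintD; try exact: continuous_overB.
by congr (_ + _); apply: eq_cint => x _; ring.
Qed.

Lemma rint_bound f a b c d (M : R) : a <= b -> c <= d ->
  edge_continuous f a b c d ->
  (forall x, a <= x <= b -> normc (f (x +i* c)) <= M) ->
  (forall x, a <= x <= b -> normc (f (x +i* d)) <= M) ->
  (forall y, c <= y <= d -> normc (f (a +i* y)) <= M) ->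
  (forall y, c <= y <= d -> normc (f (b +i* y)) <= M) ->
  normc (rint f a b c d) <= 4 * M * ((b - a) + (d - c)).
Proof.
move=> ab cd [f1 f2 f3 f4] h1 h2 h3 h4.
rewrite rint.unlock (le_trans (normcD _ _))// normcM normc_i mul1r mulrDr.
have -> : 4 * M = 2 * (M + M) by ring.
apply: lerD.
  apply: (cint_bound ab (continuous_overB f1 f2)) => x xab.
  by rewrite (le_trans (normcD _ _))// normcN lerD ?h1 ?h2.
apply: (cint_bound cd (continuous_overB f4 f3)) => x xab.
by rewrite (le_trans (normcD _ _))// normcN lerD ?h3 ?h4.
Qed.

(** An affine function differs by a constant between opposite sides, and the two resulting terms are
    opposite. *)
Lemma rint_affine (k l : C) a b c d : a <= b -> c <= d ->
  rint (fun z => k + l * z) a b c d = 0.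
Proof.
move=> ab cd; rewrite rint.unlock.
have hE x : (x +i* c : C) - (x +i* d) = 'i%C * (c - d)%:C.
  apply/eqP; rewrite eq_complex /=.
  by rewrite !(mul0r, mulr0, mul1r, subrr, oppr0, add0r, addr0, eqxx).
have vE y : (b +i* y : C) - (a +i* y) = (b - a)%:C.
  by apply/eqP; rewrite eq_complex /= subrr !eqxx.
have H u v : k + l * u - (k + l * v) = l * (u - v) by ring.
rewrite (@eq_cint _ _ (fun=> l * ('i%C * (c - d)%:C))); last first.
  by move=> x _; rewrite (H (x +i* c) (x +i* d)) hE.
rewrite [X in _ + _ * X](@eq_cint _ _ (fun=> l * (b - a)%:C)); last first.
  by move=> y _; rewrite (H (b +i* y) (a +i* y)) vE.
rewrite !cint_cst// -(opprB d c) rmorphN /=; ring.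
Qed.

Definition rect a b c d z :=
  (a <= complex.Re z <= b) && (c <= complex.Im z <= d).

Lemma edge_continuous_rect f a b c d : a <= b -> c <= d ->
  (forall z, rect a b c d z -> {for z, continuous f}) ->
  edge_continuous f a b c d.
Proof.
move=> ab cd cf; split.
- apply: continuous_over_horizontal => x xab.
  by apply: cf; rewrite /rect /= xab lexx cd.
- apply: continuous_over_horizontal => x xab.
  by apply: cf; rewrite /rect /= xab lexx cd.
- apply: continuous_over_vertical => y ycd.
  by apply: cf; rewrite /rect /= ycd lexx ab.
- apply: continuous_over_vertical => y ycd.
  by apply: cf; rewrite /rect /= ycd lexx ab.
Qed.

End rectangle_integral.

(** * Goursat's theorem and the Cauchy formula for squares *)

Section goursat.
Variable R : realType.
Local Notation C := (Cplx R).
Implicit Types (f g : C -> C) (a b c d : R) (z w : C).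

(** Convergence of the difference quotient, multiplied by [w - z]; the bound is non-strict so as to
    hold at [w = z]. *)
Lemma derivable_linear_approx f z : derivable f z 1 ->
  forall e : R, 0 < e -> exists2 r : R, 0 < r & forall w, normc (w - z) < r ->
    normc (f w - f z - 'D_1 f z * (w - z)) <= e * normc (w - z).
Proof.
move=> df e e0; pose q h := h^-1 *: ((f \o shift z) (h *: 1) - f z) : C.
have /(cvgcP (F := 0^')) /(_ _ e0) : q @ 0^' --> 'D_1 f z by [].
move=> /nbhs_normc[r r0 rP]; exists r => // w wz.
have [->|wz0] := eqVneq w z; first by rewrite !subrr mulr0 subrr normc0 mulr0.
have h0 : w - z != 0 by rewrite subr_eq0.
have := rP (w - z); rewrite /= sub0r normcN => /(_ wz h0).
have -> : q (w - z) = (w - z)^-1 * (f w - f z).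
  by rewrite /q /=; congr (_^-1 * (f _ - _)); rewrite -[_ *: _]/(_ * 1) mulr1 subrK.
set l := 'D_1 f z => H; apply/ltW.
have -> : f w - f z - l * (w - z) = - (w - z) * (l - (w - z)^-1 * (f w - f z)).
  by field.
by rewrite normcM normcN mulrC ltr_pM2r// normc_gt0.
Qed.

Lemma derivable_continuous_at f z : derivable f z 1 -> {for z, continuous f}.
Proof. by move=> /derivable1_diffP/differentiable_continuous. Qed.

Lemma normc_rect_le a b c d z w : rect a b c d z -> rect a b c d w ->
  normc (z - w) <= (b - a) + (d - c).
Proof.
move=> /andP[/andP[az zb] /andP[cz zd]] /andP[/andP[aw wb] /andP[cw wd]].
rewrite (le_trans (normc_le_ReIm _))//.
have -> : complex.Re (z - w) = complex.Re z - complex.Re w.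
  by case: (z) (w) => ? ? [].
have -> : complex.Im (z - w) = complex.Im z - complex.Im w.
  by case: (z) (w) => ? ? [].
by apply: lerD; rewrite ler_norml; apply/andP; split; lra.
Qed.

(** The integrals over the four quarters add up to the whole one, so one of them has at least a
    quarter of its modulus. *)
Lemma rint_quarter f (x y p q : R) : 0 <= p -> 0 <= q ->
  (forall z, rect x (x + p) y (y + q) z -> {for z, continuous f}) ->
  exists x' y', [/\ x <= x', x' + p / 2 <= x + p, y <= y', y' + q / 2 <= y + q &
    normc (rint f x (x + p) y (y + q)) <=
    4 * normc (rint f x' (x' + p / 2) y' (y' + q / 2))].
Proof.
move=> p0 q0 cf; pose X := x + p / 2; pose Y := y + q / 2.
have cfE a b c d : x <= a -> a <= b -> b <= x + p -> y <= c -> c <= d ->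
    d <= y + q -> edge_continuous f a b c d.
  move=> xa ab bx yc cd dy; apply: edge_continuous_rect => // z.
  move=> /andP[/andP[? ?] /andP[? ?]]; apply: cf; apply/andP; split; lra.
have xX : x <= X <= x + p by rewrite /X; lra.
have yY : y <= Y <= y + q by rewrite /Y; lra.
have [xX1 xX2] := andP xX; have [yY1 yY2] := andP yY.
have E : rint f x (x + p) y (y + q) = rint f x X y Y + rint f x X Y (y + q) +
    (rint f X (x + p) y Y + rint f X (x + p) Y (y + q)).
  have xp : x <= x + p by lra.
  have yq : y <= y + q by lra.
  have [_ _ _ cX] := cfE x X y (y + q) (lexx _) xX1 xX2 (lexx _) yq (lexx _).
  have [_ cY1 _ _] := cfE x X y Y (lexx _) xX1 xX2 (lexx _) yY1 yY2.
  have [_ cY2 _ _] := cfE X (x + p) y Y xX1 xX2 (lexx _) (lexx _) yY1 yY2.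
  rewrite (rint_splitx xX _ cX); last exact: cfE.
  rewrite (rint_splity yY _ cY1); last exact: cfE.
  by rewrite (rint_splity yY _ cY2); last exact: cfE.
have EX : X + p / 2 = x + p by rewrite /X; field.
have EY : Y + q / 2 = y + q by rewrite /Y; field.
apply: contrapT => H.
pose m := normc (rint f x (x + p) y (y + q)) / 4.
have lt_m x' y' : x <= x' -> x' + p / 2 <= x + p -> y <= y' ->
    y' + q / 2 <= y + q -> normc (rint f x' (x' + p / 2) y' (y' + q / 2)) < m.
  move=> h1 h2 h3 h4; rewrite ltNge; apply/negP => mle; apply: H; exists x', y'.
  by split => //; rewrite /m in mle; lra.
(* The lower left corners of the quarters are [(x, y)], [(x, Y)], [(X, y)] and [(X, Y)]; four
   integrals below [m] contradict the sum [E]. *)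
have /lt_m : x <= x by []; move=> /(_ y); rewrite -/X -/Y.
have /lt_m : x <= x by []; move=> /(_ Y); rewrite -/X EY.
have /lt_m := xX1; move=> /(_ y); rewrite EX -/Y.
have /lt_m := xX1; move=> /(_ Y); rewrite EX EY.
move=> /(_ (lexx _) yY1 (lexx _)) m4 /(_ (lexx _) (lexx _) yY2) m3.
move=> /(_ xX2 yY1 (lexx _)) m2 /(_ xX2 (lexx _) yY2) m1.
have : normc (rint f x (x + p) y (y + q)) < m + m + (m + m).
  rewrite E (le_lt_trans (normcD _ _))//.
  by rewrite ltrD// (le_lt_trans (normcD _ _))// ltrD.
by rewrite /m; clear; move: (normc _) => t; lra.
Qed.

(** Quartering repeatedly yields nested rectangles with a common point [z], the [n]-th integral
    being at least [I / 4 ^ n] in modulus. Near [z] the function is affine up to an error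
    [e * |w - z|], and affine functions integrate to 0, so the same integral is at most
    [4 * e * L ^ 2 / 4 ^ n]. *)
Theorem goursat f a b c d : a <= b -> c <= d ->
  (forall z, rect a b c d z -> derivable f z 1) -> rint f a b c d = 0.
Proof.
move=> ab cd df.
have cf z : rect a b c d z -> {for z, continuous f}.
  by move=> /df/derivable_continuous_at.
pose p n := (b - a) / 2 ^+ n; pose q n := (d - c) / 2 ^+ n.
have p0 n : 0 <= p n by rewrite divr_ge0 ?subr_ge0// exprn_ge0.
have q0 n : 0 <= q n by rewrite divr_ge0 ?subr_ge0// exprn_ge0.
have pS n : p n.+1 = p n / 2 by rewrite /p exprSr invfM mulrA.
have qS n : q n.+1 = q n / 2 by rewrite /q exprSr invfM mulrA.
(* A state is a level [n] with a lower left corner; the sides [p n] and [q n] are determined by the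
   level. *)
pose inside (s : nat * (R * R)) := [/\ a <= s.2.1, s.2.1 + p s.1 <= b,
  c <= s.2.2 & s.2.2 + q s.1 <= d].
pose refines (s : nat * (R * R)) (t : R * R) := [/\ s.2.1 <= t.1,
  t.1 + p s.1.+1 <= s.2.1 + p s.1, s.2.2 <= t.2,
  t.2 + q s.1.+1 <= s.2.2 + q s.1 &
  normc (rint f s.2.1 (s.2.1 + p s.1) s.2.2 (s.2.2 + q s.1)) <=
  4 * normc (rint f t.1 (t.1 + p s.1.+1) t.2 (t.2 + q s.1.+1))].
(* [choice] wants a value at every state; those violating [inside] get the dummy corner [(0, 0)]. *)
have /choice[F FP] : forall s, exists t, inside s -> refines s t.
  move=> [n [x y]].
  have [[/= h1 h2 h3 h4]|] := pselect (inside (n, (x, y))); last by exists (0, 0).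
  have [|x' [y' [x1 x2 y1 y2 xy]]] := @rint_quarter f x y _ _ (p0 n) (q0 n).
    move=> z /andP[/andP[? ?] /andP[? ?]]; apply: cf; apply/andP; split; lra.
  by exists (x', y'); rewrite /refines /= pS qS.
pose fix s n := if n is n'.+1 then F (n', s n') else (a, c).
have sin n : inside (n, s n).
  elim: n => [|n IH].
    by split => //=; rewrite /p /q expr0 divr1 addrC subrK.
  have [/= h1 h2 h3 h4 _] := FP _ IH; have [/= k1 k2 k3 k4] := IH.
  by split => /=; lra.
have sref n : refines (n, s n) (s n.+1) by exact: FP.
have sx n m : (s n).1 <= (s (n + m)%N).1 /\
    (s (n + m)%N).1 + p (n + m)%N <= (s n).1 + p n.
  elim: m => [|m [IH1 IH2]]; first by rewrite addn0.
  by rewrite addnS; have [/= h1 h2 h3 h4 _] := sref (n + m)%N; split; lra.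
have sy n m : (s n).2 <= (s (n + m)%N).2 /\
    (s (n + m)%N).2 + q (n + m)%N <= (s n).2 + q n.
  elim: m => [|m [IH1 IH2]]; first by rewrite addn0.
  by rewrite addnS; have [/= h1 h2 h3 h4 _] := sref (n + m)%N; split; lra.
have nested (u r : nat -> R) : (forall n, 0 <= r n) ->
    (forall n m, u n <= u (n + m)%N /\ u (n + m)%N + r (n + m)%N <= u n + r n) ->
    exists x, forall n, u n <= x <= u n + r n.
  (* Every lower end is below every upper end, so the supremum of the lower ends lies in all the
     segments. *)
  move=> r0 ur; exists (sup (range u)) => n.
  have ub m : u m <= u n + r n.
    have [nm|/ltnW mn] := leqP n m.
      have := (ur n (m - n)%N).2; rewrite subnKC//.
      by have := r0 m; lra.
    by have := (ur m (n - m)%N).1; rewrite subnKC//; have := r0 n; lra.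
  apply/andP; split.
    by apply: ub_le_sup; [exists (u n + r n) => _ [m _ <-]|exists n].
  by apply: ge_sup => [|_ [m _ <-]//]; exists (u 0), 0.
have [x xs] := nested (fun n => (s n).1) p p0 sx.
have [y ys] := nested (fun n => (s n).2) q q0 sy.
pose z : C := x +i* y.
have I4 n : normc (rint f a b c d) <=
    4 ^+ n * normc (rint f (s n).1 ((s n).1 + p n) (s n).2 ((s n).2 + q n)).
  elim: n => [|n IH].
    by rewrite expr0 mul1r /= /p /q expr0 !divr1 !(addrC _ (_ - _)) !subrK.
  apply: (le_trans IH); rewrite exprSr -mulrA ler_wpM2l ?exprn_ge0//.
  by have [] := sref n.
have rz n : rect (s n).1 ((s n).1 + p n) (s n).2 ((s n).2 + q n) z.
  by apply/andP.
have rab n w : rect (s n).1 ((s n).1 + p n) (s n).2 ((s n).2 + q n) w ->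
    rect a b c d w.
  have [/= h1 h2 h3 h4] := sin n => /andP[/andP[? ?] /andP[? ?]].
  by apply/andP; split; lra.
apply/eqP; rewrite -normc_eq0; apply/eqP/le_anti; rewrite normc_ge0 andbT.
rewrite leNgt; apply/negP => I0.
pose L := (b - a) + (d - c); pose I := normc (rint f a b c d).
have L0 : 0 <= L by rewrite /L; lra.
have L21 : 0 < L ^+ 2 + 1 by rewrite ltr_wpDl ?sqr_ge0.
(* This makes the final bound [4 * e * L ^+ 2] at most [I / 2]; the [+ 1] covers [L = 0]. *)
have e0 : 0 < I / (8 * (L ^+ 2 + 1)) by rewrite divr_gt0// mulr_gt0.
have [r r0 fr] := derivable_linear_approx (df _ (rab 0%N _ (rz 0%N))) e0.
set e := I / _ in e0 fr; set l := 'D_1 f z in fr.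
have [n Ln] : exists n, L / 2 ^+ n < r.
  have nP := truncnS_gt (L / r); set n := (Num.trunc (L / r)).+1 in nP.
  exists n; rewrite ltr_pdivrMr ?exprn_gt0// -ltr_pdivrMl// mulrC (lt_trans nP)//.
  by rewrite -natrX ltr_nat ltn_expl.
pose g w := f w - f z - l * (w - z).
have pqL : p n + q n = L / 2 ^+ n by rewrite /p /q /L -mulrDl.
have [/= h1 h2 h3 h4] := sin n.
have xle : (s n).1 <= (s n).1 + p n by have := p0 n; lra.
have yle : (s n).2 <= (s n).2 + q n by have := q0 n; lra.
have gle w : rect (s n).1 ((s n).1 + p n) (s n).2 ((s n).2 + q n) w ->
    normc (g w) <= e * (L / 2 ^+ n).
  move=> rw; have wz := normc_rect_le rw (rz n).
  have {}wz : normc (w - z) <= L / 2 ^+ n by rewrite -pqL; lra.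
  by rewrite (le_trans (fr w _))// ?(le_lt_trans wz)// ler_wpM2l// ltW.
have cA (k : C) w : {for w, continuous (fun w => k + l * w)}.
  apply: (cvgD (F := nbhs w)); first exact: cvg_cst.
  by apply: (cvgM (F := nbhs w)); [exact: cvg_cst|exact: cvg_id].
have cfw w : rect (s n).1 ((s n).1 + p n) (s n).2 ((s n).2 + q n) w ->
    {for w, continuous f} by move=> /rab/cf.
have cg w : rect (s n).1 ((s n).1 + p n) (s n).2 ((s n).2 + q n) w ->
    {for w, continuous g}.
  move=> rw.
  apply: (@continuousB _ _ _ (fun w => f w - f z) (fun w => l * (w - z))).
    by apply: (@continuousB _ _ _ f (fun=> f z)); [exact: cfw|exact: cst_continuous].
  apply: (@continuousM _ _ (fun=> l) (fun w => w - z)); first exact: cst_continuous.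
  by apply: (@continuousB _ _ _ id (fun=> z)); [exact: cvg_id|exact: cst_continuous].
(* [f] and its remainder [g] differ by an affine function. *)
have fg : rint f (s n).1 ((s n).1 + p n) (s n).2 ((s n).2 + q n) =
    rint g (s n).1 ((s n).1 + p n) (s n).2 ((s n).2 + q n).
  have fE w : f w = g w + (f z - l * z + l * w) by rewrite /g; ring.
  rewrite -[RHS]addr0 -(rint_affine (f z - l * z) l xle yle).
  rewrite -rintD; last exact: edge_continuous_rect xle yle (fun w _ => cA _ w).
    by apply: eq_rint => // ? _; rewrite -fE.
  exact: edge_continuous_rect xle yle cg.
have := I4 n; rewrite fg => Ile.
have gb : normc (rint g (s n).1 ((s n).1 + p n) (s n).2 ((s n).2 + q n)) <=
    4 * (e * (L / 2 ^+ n)) * (L / 2 ^+ n).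
  have -> : L / 2 ^+ n = ((s n).1 + p n - (s n).1) + ((s n).2 + q n - (s n).2).
    by rewrite -pqL; ring.
  have E : (s n).1 + p n - (s n).1 + ((s n).2 + q n - (s n).2) = L / 2 ^+ n.
    by rewrite -pqL; ring.
  by apply: rint_bound (edge_continuous_rect xle yle cg) _ _ _ _ => // t tab;
    rewrite E gle// /rect /= tab lexx ?xle ?yle.
have : I <= 4 * e * L ^+ 2.
  apply: (le_trans Ile); apply: (le_trans (ler_wpM2l (exprn_ge0 n _) gb)) => //.
  have -> : 4 ^+ n = (2 ^+ n) ^+ 2 :> R.
    by rewrite -exprM mulnC exprM; congr (_ ^+ _); rewrite -natrX.
  have : (2 : R) ^+ n != 0 by rewrite expf_neq0.
  by move: (2 ^+ n) => t t0; rewrite le_eqVlt; apply/orP; left; apply/eqP; field.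
apply/negP; rewrite -ltNge.
have -> : 4 * e * L ^+ 2 = I / 2 * (L ^+ 2 / (L ^+ 2 + 1)).
  by rewrite /e; field; rewrite gt_eqF.
rewrite (@le_lt_trans _ _ (I / 2))//; last by rewrite /I; lra.
rewrite ler_piMr// ?divr_ge0 ?normc_ge0// ler_pdivrMr// mul1r.
by rewrite lerDl.
Qed.

End goursat.

(** * Shrinking the contour around a hole *)

Section cauchy.
Variable R : realType.
Local Notation C := (Cplx R).
Implicit Types (f g : C -> C) (a b c d s : R) (z w : C).

Definition edge a b c d z := rect a b c d z &&
  [|| complex.Re z == a, complex.Re z == b, complex.Im z == c | complex.Im z == d].

Lemma edge_rect a b c d z : edge a b c d z -> rect a b c d z.
Proof. by case/andP. Qed.

Section edge.
Variables (a b c d : R) (ab : a <= b) (cd : c <= d).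

Let e1 x : a <= x <= b -> edge a b c d (x +i* c).
Proof. by move=> xab; rewrite /edge /rect /= xab lexx cd eqxx !orbT. Qed.
Let e2 x : a <= x <= b -> edge a b c d (x +i* d).
Proof. by move=> xab; rewrite /edge /rect /= xab lexx cd eqxx !orbT. Qed.
Let e3 y : c <= y <= d -> edge a b c d (a +i* y).
Proof. by move=> ycd; rewrite /edge /rect /= ycd lexx ab eqxx. Qed.
Let e4 y : c <= y <= d -> edge a b c d (b +i* y).
Proof. by move=> ycd; rewrite /edge /rect /= ycd lexx ab eqxx !orbT. Qed.

Lemma edge_continuousP f : (forall z, edge a b c d z -> {for z, continuous f}) ->
  edge_continuous f a b c d.
Proof.
move=> cf; split.
- by apply: continuous_over_horizontal => x /e1; exact: cf.
- by apply: continuous_over_horizontal => x /e2; exact: cf.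
- by apply: continuous_over_vertical => x /e3; exact: cf.
- by apply: continuous_over_vertical => x /e4; exact: cf.
Qed.

Lemma rint_bound_edge f (M : R) : edge_continuous f a b c d ->
  (forall z, edge a b c d z -> normc (f z) <= M) ->
  normc (rint f a b c d) <= 4 * M * ((b - a) + (d - c)).
Proof.
move=> cf fM; apply: rint_bound => // x xab.
- by apply: fM; exact: e1.
- by apply: fM; exact: e2.
- by apply: fM; exact: e3.
- by apply: fM; exact: e4.
Qed.

End edge.

Definition hole a b c d z :=
  (a < complex.Re z < b) && (c < complex.Im z < d).

Lemma rint_hole f a b c d a' b' c' d' : a <= a' -> a' <= b' -> b' <= b ->
  c <= c' -> c' <= d' -> d' <= d ->
  (forall z, rect a b c d z -> ~~ hole a' b' c' d' z -> derivable f z 1) ->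
  rint f a b c d = rint f a' b' c' d'.
Proof.
move=> aa ab bb cc cd dd df.
have cf z : rect a b c d z -> ~~ hole a' b' c' d' z -> {for z, continuous f}.
  by move=> rz hz; apply: derivable_continuous_at; exact: df.
have V x : a <= x <= b -> (x <= a') || (b' <= x) ->
    continuous_over (fun y => f (x +i* y)) c d.
  move=> xab xh; apply: continuous_over_vertical => y ycd; apply: cf.
    by rewrite /rect /= xab ycd.
  by rewrite /hole /= !ltNge; case/orP: xh => -> //=; rewrite andbF.
have H y : c <= y <= d -> (y <= c') || (d' <= y) ->
    continuous_over (fun x => f (x +i* y)) a b.
  move=> ycd yh; apply: continuous_over_horizontal => x xab; apply: cf.
    by rewrite /rect /= xab ycd.
  by rewrite /hole /= !ltNge; case/orP: yh => -> //=; rewrite ?andbF.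
have Va := V a; have Va' := V a'; have Vb' := V b'; have Vb := V b.
have Hc := H c; have Hc' := H c'; have Hd' := H d'; have Hd := H d.
have {}Va : continuous_over (fun y => f (a +i* y)) c d.
  by apply: Va; [lra|apply/orP; left; lra].
have {}Va' : continuous_over (fun y => f (a' +i* y)) c d.
  by apply: Va'; [lra|apply/orP; left; lra].
have {}Vb' : continuous_over (fun y => f (b' +i* y)) c d.
  by apply: Vb'; [lra|apply/orP; right; lra].
have {}Vb : continuous_over (fun y => f (b +i* y)) c d.
  by apply: Vb; [lra|apply/orP; right; lra].
have {}Hc : continuous_over (fun x => f (x +i* c)) a b.
  by apply: Hc; [lra|apply/orP; left; lra].
have {}Hc' : continuous_over (fun x => f (x +i* c')) a b.
  by apply: Hc'; [lra|apply/orP; left; lra].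
have {}Hd' : continuous_over (fun x => f (x +i* d')) a b.
  by apply: Hd'; [lra|apply/orP; right; lra].
have {}Hd : continuous_over (fun x => f (x +i* d)) a b.
  by apply: Hd; [lra|apply/orP; right; lra].
have sub (x1 x2 y : R) : a <= x1 -> x2 <= b ->
    continuous_over (fun x => f (x +i* y)) a b ->
    continuous_over (fun x => f (x +i* y)) x1 x2.
  by move=> h1 h2; exact: continuous_overS.
have sub' (y1 y2 x : R) : c <= y1 -> y2 <= d ->
    continuous_over (fun y => f (x +i* y)) c d ->
    continuous_over (fun y => f (x +i* y)) y1 y2.
  by move=> h1 h2; exact: continuous_overS.
have G x1 x2 y1 y2 : a <= x1 -> x1 <= x2 -> x2 <= b ->
    c <= y1 -> y1 <= y2 -> y2 <= d ->
    (forall z, rect x1 x2 y1 y2 z -> ~~ hole a' b' c' d' z) ->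
    rint f x1 x2 y1 y2 = 0.
  move=> ? ? ? ? ? ? hz; apply: goursat => // z rz; apply: df; last exact: hz.
  by move: rz => /andP[/andP[? ?] /andP[? ?]]; apply/andP; split; lra.
rewrite (@rint_splitx _ a'); [|by lra|by split|by []].
rewrite (@rint_splitx _ b' _ a' b); [|by lra| |by []]; last first.
  by split => //; apply: sub; rewrite ?lexx//; lra.
rewrite (@rint_splity _ c' _ a' b' c d); [|by lra| |by apply: sub Hc'; lra]; last first.
  by split => //; apply: sub; rewrite ?lexx//; lra.
rewrite (@rint_splity _ d' _ a' b' c' d); [|by lra| |by apply: sub Hd'; lra]; last first.
  by split; [apply: sub Hc'|apply: sub Hd|apply: sub' Va'|apply: sub' Vb']; lra.
have G1 : rint f a a' c d = 0.
  apply: G; [lra|lra|lra|lra|lra|lra|].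
  by move=> z /andP[/andP[_ za] _]; rewrite /hole ltNge za.
have G2 : rint f b' b c d = 0.
  apply: G; [lra|lra|lra|lra|lra|lra|].
  by move=> z /andP[/andP[za _] _]; rewrite /hole [_ < b']ltNge za andbF.
have G3 : rint f a' b' c c' = 0.
  apply: G; [lra|lra|lra|lra|lra|lra|].
  by move=> z /andP[_ /andP[_ za]]; rewrite /hole [c' < _]ltNge za andbF.
have G4 : rint f a' b' d' d = 0.
  apply: G; [lra|lra|lra|lra|lra|lra|].
  by move=> z /andP[_ /andP[za _]]; rewrite /hole [_ < d']ltNge za !andbF.
by rewrite G1 G2 G3 G4 !add0r !addr0.
Qed.

End cauchy.

(** * The integral of the Cauchy kernel over a square *)

Section quadratic_estimate.
Variable R : realType.
Local Notation C := (Cplx R).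
Implicit Types (f g : C -> C) (s : R) (z w : C).

Lemma derivable_invB z w : z != w -> derivable (fun z : C => (z - w)^-1) z 1.
Proof.
move=> zw; apply: derivableV; first by rewrite subr_eq0.
by apply: derivableB; [exact: derivable_id|exact: derivable_cst].
Qed.

Lemma edge_square_ge s z : 0 <= s -> edge (- s) s (- s) s z -> s <= normc z.
Proof.
move=> s0 /andP[_] /or4P[] /eqP zs.
- by apply: le_trans (Re_le_normc z); rewrite zs normrN ler_norm.
- by apply: le_trans (Re_le_normc z); rewrite zs ler_norm.
- by apply: le_trans (Im_le_normc z); rewrite zs normrN ler_norm.
- by apply: le_trans (Im_le_normc z); rewrite zs ler_norm.
Qed.

Lemma normc_hole_square s w : normc w < s -> hole (- s) s (- s) s w.
Proof.
move=> ws; rewrite /hole -!ltr_norml.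
by rewrite (le_lt_trans (Re_le_normc w))// (le_lt_trans (Im_le_normc w)).
Qed.

Lemma edge_square_neq s z w : normc w < s -> edge (- s) s (- s) s z -> z != w.
Proof.
move=> ws ez; apply: contraTneq ws => <-; rewrite -leNgt edge_square_ge//.
by move: ez => /andP[/andP[/andP[? ?] _] _]; lra.
Qed.

(** This stands where the Cauchy formula has [2 pi i]: it is shown to be constant in [w] inside the
    square and at least 2 in modulus. *)
Definition square_kernel s w : C := rint (fun z => (z - w)^-1) (- s) s (- s) s.

(** A passage to the limit in elementary form: each use supplies a convenient [u] below a given [t].
    The proof divides by [|K| + 1], which is positive whatever [K] is. *)
Lemma eq0_of_small_multiples (x K : R) : 0 <= x ->
  (forall t : R, 0 < t -> exists2 u, 0 < u < t & x <= K * u) -> x = 0.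
Proof.
move=> x0 H; apply/le_anti; rewrite x0 andbT leNgt; apply/negP => xgt0.
have K1 : 0 < `|K| + 1 by rewrite ltr_wpDl.
have [u /andP[u0 ut] xu] := H (x / (`|K| + 1)) (divr_gt0 xgt0 K1).
suff : x < x by rewrite ltxx.
rewrite (le_lt_trans xu)// (@le_lt_trans _ _ (`|K| * u))//.
  by rewrite ler_wpM2r ?ler_norm// ltW.
by move: ut; rewrite ltr_pdivlMr//; have := normr_ge0 K; nra.
Qed.

(* The difference of the two integrands is holomorphic outside the square, so
   its integral is the same over arbitrarily large squares [-L, L]^2, where it
   is O(1/L). *)
Lemma square_kernel_const s w : 0 < s -> normc w < s ->
  square_kernel s w = square_kernel s 0.
Proof.
move=> s0 ws; apply/eqP; rewrite -subr_eq0 -normc_eq0.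
pose h z : C := (z - w)^-1 + -1 * (z - 0)^-1.
have z0 : normc (0 : C) < s by rewrite normc0.
have dh z : z != w -> z != 0 -> derivable h z 1.
  move=> zw zz; apply: derivableD; first exact: derivable_invB.
  by apply: derivableM; [exact: derivable_cst|exact: derivable_invB].
have ss : - s <= s by lra.
have -> : square_kernel s w - square_kernel s 0 = rint h (- s) s (- s) s.
  have c u : normc u < s ->
      edge_continuous (fun z => (z - u)^-1) (- s) s (- s) s.
    move=> us; apply: (edge_continuousP ss ss) => z ez.
    apply: derivable_continuous_at; exact/derivable_invB/(edge_square_neq us).
  have -> : square_kernel s w - square_kernel s 0 =
      square_kernel s w + -1 * square_kernel s 0 by ring.
  rewrite /square_kernel -rintZ; last exact: c.
  rewrite -rintD; [by []|exact: c|].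
  apply: (edge_continuousP ss ss) => z ez; apply: derivable_continuous_at.
  apply: derivableM; first exact: derivable_cst.
  exact/derivable_invB/(edge_square_neq z0).
apply/eqP; apply: (@eq0_of_small_multiples _ (64 * normc w)); first exact: normc_ge0.
(* [L >= 2 * s] keeps [w] at distance at least [L / 2] from the large square's sides, and
   [L > 1 / t] makes [L^-1] admissible. *)
move=> t t0; pose L := 2 * s + t^-1 * 2; have ti : 0 < t^-1 by rewrite invr_gt0.
have L0 : 0 < L by rewrite /L; lra.
have sL : 2 * s <= L by rewrite /L; lra.
exists L^-1.
  rewrite invr_gt0 L0 /= invf_plt ?posrE//.
  by rewrite /L; lra.
have LL : - L <= L by lra.
have nh z : edge (- L) L (- L) L z -> z != w /\ z != 0.
  have wL : normc w < L by lra.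
  have zL : normc (0 : C) < L by lra.
  by move=> ez; rewrite (edge_square_neq wL ez) (edge_square_neq zL ez).
have -> : rint h (- s) s (- s) s = rint h (- L) L (- L) L.
  apply/esym/rint_hole; [lra|lra|lra|lra|lra|lra|] => z _ zh.
  by apply: dh; apply: contraNneq zh => ->; exact: normc_hole_square.
have -> : 64 * normc w * L^-1 =
    4 * (4 * normc w / L ^+ 2) * ((L - - L) + (L - - L)).
  by field; rewrite gt_eqF.
apply: (rint_bound_edge LL LL).
  apply: (edge_continuousP LL LL) => z /nh[zw zz].
  by apply: derivable_continuous_at; exact: dh.
move=> z ez; have [zw zz] := nh _ ez.
have zL := edge_square_ge (ltW L0) ez.
have zwL : L / 2 <= normc (z - w).
  have := normcD (z - w) w; rewrite subrK => H.
  by move: (normc z) (normc w) (normc (z - w)) ws zL H => a b c; lra.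
(* The two poles cancel to order [1 / L ^ 2], which beats the perimeter of order [L]. *)
have -> : h z = w / ((z - w) * z).
  by rewrite /h subr0; field; rewrite zz subr_eq0 zw.
rewrite normcM normcV normcM ler_pdivrMr; last first.
  apply: mulr_gt0; last exact: lt_le_trans zL.
  by apply: lt_le_trans zwL; exact: divr_gt0.
have -> : 4 * normc w / L ^+ 2 * (normc (z - w) * normc z) =
    normc w * ((normc (z - w) / (L / 2)) * (normc z / L)) * 2.
  by field; rewrite gt_eqF.
have H1 : 1 <= normc (z - w) / (L / 2) by rewrite ler_pdivlMr ?mul1r// divr_gt0.
have H2 : 1 <= normc z / L by rewrite ler_pdivlMr ?mul1r.
move: (_ / (L / 2)) (_ / L) H1 H2 (normc_ge0 w) => x y x1 y1; move: (normc w) => v v0.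
have : 1 <= x * y by nra.
by nra.
Qed.

(* The kernel is 4i times the integral of s / (s^2 + t^2) over [-s, s], whose
   integrand is within 1 / (4 s) of 3 / (4 s); a crude bound spares the
   evaluation pi / 2. *)
Lemma square_kernel_ge s : 0 < s -> 2 <= normc (square_kernel s 0).
Proof.
move=> s0; pose k (t : R) : C := (s / (s ^+ 2 + t ^+ 2))%:C.
have st (t : R) : 0 < s ^+ 2 + t ^+ 2 by rewrite ltr_wpDr ?sqr_ge0 ?exprn_gt0.
have st' (t : R) : 0 < t ^+ 2 + s ^+ 2 by rewrite addrC.
have ck (j : C) : continuous_over (fun t => j * k t) (- s) s.
  move=> t _; apply: (@continuousM _ _ (fun=> j) k).
    exact: cst_continuous.
  apply: (cvg_cplx (F := nbhs t)); last exact: cvg_cst.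
  apply: (cvgM (F := nbhs t)); first exact: cvg_cst.
  apply: (cvgV (F := nbhs t)); first by rewrite gt_eqF.
  apply: (cvgD (F := nbhs t)); first exact: cvg_cst.
  exact: exprn_continuous.
have ck1 : continuous_over k (- s) s.
  move=> t ts; have := ck 1 t ts.
  by have -> : (fun t => 1 * k t) = k by apply/funext => u; rewrite mul1r.
have -> : square_kernel s 0 = 4 * 'i%C * cint k (- s) s.
  rewrite /square_kernel rint.unlock.
  rewrite (@eq_cint _ _ (fun t => 2 * 'i%C * k t)); last first.
    move=> x _; rewrite !subr0; apply/eqP; rewrite eq_complex /k /=.
    by apply/andP; split; apply/eqP; field; rewrite !gt_eqF.
  rewrite (cintZ _ ck1).
  rewrite [X in _ + _ * X](@eq_cint _ _ (fun t => 2 * k t)); last first.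
    move=> x _; rewrite !subr0; apply/eqP; rewrite eq_complex /k /=.
    by apply/andP; split; apply/eqP; field; rewrite !gt_eqF.
  by rewrite (cintZ _ ck1); ring.
rewrite normcM normcM normc_i mulr1.
have -> : normc (4 : C) = 4.
  by rewrite -(rmorph_nat (real_complex R)) normc_real ger0_norm.
have ss : - s <= s by lra.
(* [3 / 2] is the midpoint [3 / (4 * s)] of the range of the integrand times the length [2 * s]. The
   integral is then at least [1 / 2] in modulus, and the factor 4 turns this into 2. *)
suff : normc (cint k (- s) s - (3 / 2)%:C) <= 1.
  have := normcD (cint k (- s) s) ((3 / 2)%:C - cint k (- s) s).
  rewrite addrC subrK normcB normc_real ger0_norm; last by lra.
  by move: (normc (cint _ _ _)) (normc (_ - _)) => x y; lra.
pose m : C := (- (3 / (4 * s)))%:C.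
have cm : continuous_over (fun=> m) (- s) s.
  by move=> t _; exact: cst_continuous.
have -> : cint k (- s) s - (3 / 2)%:C = cint (fun t => k t + m) (- s) s.
  rewrite (cintD ck1 cm) (cint_cst m ss) /m -rmorphM /=; congr (_ + _); rewrite -rmorphN /=.
  by congr (_%:C); field; rewrite gt_eqF.
have -> : 1 = 2 * ((4 * s)^-1) * (s - - s) by field; rewrite gt_eqF.
apply: (cint_bound ss) => [t ts|t /andP[ts1 ts2]].
  apply: (cvgD (F := nbhs t)); first exact: ck1.
  exact: cvg_cst.
rewrite /k /m -rmorphD /= normc_real.
have t2 : t ^+ 2 <= s ^+ 2 by nra.
have s20 : 0 < s ^+ 2 by rewrite exprn_gt0.
rewrite ler_norml; apply/andP; split.
  rewrite -subr_ge0.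
  have -> : s / (s ^+ 2 + t ^+ 2) - 3 / (4 * s) - - (4 * s)^-1 =
     (s ^+ 2 - t ^+ 2) / ((s ^+ 2 + t ^+ 2) * (2 * s)).
    by field; rewrite !gt_eqF.
  by rewrite divr_ge0 ?subr_ge0// mulr_ge0 ?ltW// mulr_gt0.
rewrite -subr_ge0.
have -> : (4 * s)^-1 - (s / (s ^+ 2 + t ^+ 2) - 3 / (4 * s)) =
   t ^+ 2 / ((s ^+ 2 + t ^+ 2) * s).
  by field; rewrite !gt_eqF.
by rewrite divr_ge0 ?sqr_ge0// mulr_ge0 ?ltW.
Qed.

End quadratic_estimate.

(** * The Cauchy formula on a square and the quadratic Taylor estimate *)

Section cauchy_formula.
Variables (R : realType) (f : Cplx R -> Cplx R) (s : R).
Local Notation C := (Cplx R).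
Hypothesis s0 : 0 < s.
Hypothesis df : forall z, rect (- s) s (- s) s z -> derivable f z 1.
Implicit Types (z w : C).

Let ss : - s <= s.
Proof. by rewrite (@le_trans _ _ 0) ?oppr_le0 ?ltW. Qed.

Let edge_derivable_div z w : normc w < s -> edge (- s) s (- s) s z ->
  derivable (fun z => (z - w)^-1 * f z) z 1.
Proof.
move=> ws ez; apply: derivableM; last exact/df/edge_rect.
exact/derivable_invB/(edge_square_neq ws).
Qed.

(* The difference quotient of f at w is bounded, so shrinking the square towards
   w shows that its integral is 0. *)
Lemma cauchy_formula w : normc w < s ->
  rint (fun z => (z - w)^-1 * f z) (- s) s (- s) s = f w * square_kernel s w.
Proof.
move=> ws; pose g z : C := (z - w)^-1 * (f z - f w).
have hw := normc_hole_square ws.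
have rw : rect (- s) s (- s) s w.
  move: hw; rewrite /hole /rect => /andP[/andP[h1 h2] /andP[h3 h4]].
  by rewrite !ltW.
have dg z : rect (- s) s (- s) s z -> z != w -> derivable g z 1.
  move=> rz zw; apply: derivableM; first exact: derivable_invB.
  by apply: derivableB; [exact: df|exact: derivable_cst].
have cg : edge_continuous g (- s) s (- s) s.
  apply: (edge_continuousP ss ss) => z ez; apply: derivable_continuous_at.
  by apply: dg; [exact: edge_rect|exact: (edge_square_neq ws)].
have ck : edge_continuous (fun z => (z - w)^-1) (- s) s (- s) s.
  apply: (edge_continuousP ss ss) => z ez; apply: derivable_continuous_at.
  exact/derivable_invB/(edge_square_neq ws).
have cfk : edge_continuous (fun z => f w * (z - w)^-1) (- s) s (- s) s.
  apply: (edge_continuousP ss ss) => z ez; apply: derivable_continuous_at.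
  apply: derivableM; first exact: derivable_cst.
  exact/derivable_invB/(edge_square_neq ws).
have -> : (fun z => (z - w)^-1 * f z) = (fun z => g z + f w * (z - w)^-1).
  by apply/funext => z; rewrite /g; ring.
rewrite (rintD cg cfk) (rintZ (f w) ck) -[RHS]add0r; congr (_ + _).
apply/eqP; rewrite -normc_eq0; apply/eqP.
have [r r0 fr] := derivable_linear_approx (df rw) ltr01.
set l := 'D_1 f w in fr; pose K := normc l + 1.
have K0 : 0 < K by rewrite ltr_wpDl ?normc_ge0.
have gK z : normc (z - w) < r -> z != w -> normc (g z) <= K.
  move=> zr zw; have zw0 : 0 < normc (z - w) by rewrite normc_gt0 subr_eq0.
  rewrite normcM normcV mulrC ler_pdivrMr// /K mulrDl -normcM.
  have -> : f z - f w = l * (z - w) + (f z - f w - l * (z - w)) by ring.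
  by rewrite (le_trans (normcD _ _))// lerD2l fr.
have [/andP[w1 w2] /andP[w3 w4]] := andP hw.
apply: (@eq0_of_small_multiples _ _ (16 * K)); first exact: normc_ge0.
move=> t t0.
have [u /andP[u0 ut] [h1 h2 h3 h4 h5]] : exists2 u, 0 < u < t &
  [/\ u < (complex.Re w + s), u < (s - complex.Re w), u < (complex.Im w + s),
      u < (s - complex.Im w) & 2 * u < r].
  (* The small square must lie inside the large one and within [r] of [w], its sides being within
     [2 * u] of [w]; taking [u] to be half of this minimum makes all inequalities strict. *)
  pose v := Num.min t (Num.min (r / 2) (Num.min (complex.Re w + s)
    (Num.min (s - complex.Re w) (Num.min (complex.Im w + s) (s - complex.Im w))))).
  have v0 : 0 < v by rewrite !lt_min t0 divr_gt0//=; apply/and4P; split; lra.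
  have : v <= v by [].
  rewrite {2}/v !le_min => /andP[v1 /andP[v2 /and4P[v3 v4 v5 v6]]].
  by exists (v / 2); [apply/andP; split; lra|split; lra].
exists u; first by rewrite u0.
pose W1 := complex.Re w; pose W2 := complex.Im w.
rewrite -/W1 -/W2 in h1 h2 h3 h4 w1 w2 w3 w4.
have -> : rint g (- s) s (- s) s = rint g (W1 - u) (W1 + u) (W2 - u) (W2 + u).
  apply: rint_hole; [lra|lra|lra|lra|lra|lra|] => z rz hz.
  apply: dg => //; apply: contraNneq hz => ->.
  by rewrite /hole -/W1 -/W2; apply/andP; split; lra.
have uu1 : W1 - u <= W1 + u by lra.
have uu2 : W2 - u <= W2 + u by lra.
have -> : 16 * K * u = 4 * K * (W1 + u - (W1 - u) + (W2 + u - (W2 - u))) by ring.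
have ew z : edge (W1 - u) (W1 + u) (W2 - u) (W2 + u) z ->
    normc (z - w) < r /\ z != w.
  have E1 : complex.Re (z - w) = complex.Re z - W1.
    by rewrite /W1; case: (z) (w) => ? ? [].
  have E2 : complex.Im (z - w) = complex.Im z - W2.
    by rewrite /W2; case: (z) (w) => ? ? [].
  move=> /andP[/andP[/andP[? ?] /andP[? ?]] ez]; split.
    rewrite (le_lt_trans (normc_le_ReIm _))// E1 E2 (le_lt_trans _ h5)//.
    by rewrite mulr_natl mulr2n lerD// ler_norml; apply/andP; split; lra.
  apply: contraTneq ez => ->; rewrite -/W1 -/W2.
  by rewrite !negb_or; apply/and4P; split; apply/eqP; lra.
apply: (rint_bound_edge uu1 uu2).
  apply: (edge_continuousP uu1 uu2) => z ez; apply: derivable_continuous_at.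
  apply: dg; last by case: (ew _ ez).
  by move: ez => /andP[/andP[/andP[? ?] /andP[? ?]] _]; apply/andP; split; lra.
by move=> z /ew[? ?]; exact: gK.
Qed.

Variable M : R.
Hypothesis fM : forall z, rect (- s) s (- s) s z -> normc (f z) <= M.

Let M0 : 0 <= M.
Proof.
have sp := s0.
apply: le_trans (fM (z := 0) _); first exact: normc_ge0.
by rewrite /rect /=; apply/andP; split; lra.
Qed.

(** Combining the Cauchy formulas at [w] and 0 with the integral for the derivative at 0 leaves the
    kernel [w ^ 2 / ((z - w) * z ^ 2)], of modulus at most [2 * |w| ^ 2 / s ^ 3] on the sides. *)
Lemma quadratic_remainder : exists A : C, forall w, normc w <= s / 2 ->
  normc (f w - f 0 - A * w) <= 16 * M * (normc w / s) ^+ 2.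
Proof.
have sp := s0; pose k0 := square_kernel s 0.
have k2 : 2 <= normc k0 := square_kernel_ge s0.
have k0n : k0 != 0 by rewrite -normc_gt0 (lt_le_trans _ k2).
have z0 : normc (0 : C) < s by rewrite normc0.
(* [k0^-1 * B] is the Cauchy integral for the derivative at 0. *)
pose B := rint (fun z => (z - 0)^-1 * ((z - 0)^-1 * f z)) (- s) s (- s) s.
exists (k0^-1 * B) => w w2.
have ws : normc w < s by lra.
have cE w' : normc w' < s ->
    edge_continuous (fun z => (z - w')^-1 * f z) (- s) s (- s) s.
  move=> w's; apply: (edge_continuousP ss ss) => z ez.
  exact/derivable_continuous_at/edge_derivable_div.
have cE2 : edge_continuous (fun z => (z - 0)^-1 * ((z - 0)^-1 * f z))
    (- s) s (- s) s.
  apply: (edge_continuousP ss ss) => z ez; apply: derivable_continuous_at.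
  apply: derivableM; last exact: edge_derivable_div.
  exact/derivable_invB/(edge_square_neq z0).
pose h z := (z - w)^-1 * f z +
  (-1 * ((z - 0)^-1 * f z) + (- w) * ((z - 0)^-1 * ((z - 0)^-1 * f z))).
have zZ (k : C) (g : C -> C) : edge_continuous g (- s) s (- s) s ->
    edge_continuous (fun z => k * g z) (- s) s (- s) s.
  have cz (u : R -> C) : continuous_over u (- s) s ->
      continuous_over (fun t => k * u t) (- s) s.
    move=> cu t ts; apply: (@continuousM _ _ (fun=> k) u).
      exact: cst_continuous.
    exact: cu.
  by case=> c1 c2 c3 c4; split; exact: cz.
have zD (g g' : C -> C) : edge_continuous g (- s) s (- s) s ->
    edge_continuous g' (- s) s (- s) s ->
    edge_continuous (fun z => g z + g' z) (- s) s (- s) s.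
  have cD (u v : R -> C) : continuous_over u (- s) s ->
      continuous_over v (- s) s -> continuous_over (fun t => u t + v t) (- s) s.
    move=> cu cv t ts; apply: (@continuousD _ _ _ u v).
      exact: cu.
    exact: cv.
  by case=> c1 c2 c3 c4 [d1 d2 d3 d4]; split; exact: cD.
have cN : edge_continuous (fun z => -1 * ((z - 0)^-1 * f z) +
    (- w) * ((z - 0)^-1 * ((z - 0)^-1 * f z))) (- s) s (- s) s.
  exact: zD (zZ _ _ (cE _ z0)) (zZ _ _ cE2).
have ch : edge_continuous h (- s) s (- s) s.
  exact: zD (cE _ ws) cN.
have E : f w - f 0 - k0^-1 * B * w = k0^-1 * rint h (- s) s (- s) s.
  rewrite (rintD (cE _ ws) cN) (rintD (zZ _ _ (cE _ z0)) (zZ _ _ cE2)).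
  rewrite (rintZ (-1) (cE _ z0)) (rintZ (- w) cE2).
  rewrite (cauchy_formula ws) (cauchy_formula z0) (square_kernel_const s0 ws).
  by rewrite -/k0 -/B; field.
rewrite E normcM normcV.
have hb : normc (rint h (- s) s (- s) s) <=
    4 * (2 * M * normc w ^+ 2 / s ^+ 3) * ((s - - s) + (s - - s)).
  apply: (rint_bound_edge ss ss ch) => z ez.
  have zw := edge_square_neq ws ez; have zz := edge_square_neq z0 ez.
  have -> : h z = f z * w ^+ 2 / ((z - w) * z ^+ 2).
    by rewrite /h subr0; field; rewrite zz subr_eq0 zw.
  have zs := edge_square_ge (ltW s0) ez.
  have zws : s / 2 <= normc (z - w).
    have := normcD (z - w) w; rewrite subrK => H.
    by move: (normc z) (normc w) (normc (z - w)) w2 zs H => a b c; lra.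
  rewrite normcM normcV (normcM (f z)) (normcM (z - w)) !normcX.
  have zw0 : 0 < normc (z - w) by rewrite normc_gt0 subr_eq0.
  have zz0 : 0 < normc z by rewrite normc_gt0.
  rewrite ler_pdivrMr; last by rewrite mulr_gt0// exprn_gt0.
  have -> : 2 * M * normc w ^+ 2 / s ^+ 3 * (normc (z - w) * normc z ^+ 2) =
     M * normc w ^+ 2 * ((normc (z - w) / (s / 2)) * (normc z / s) ^+ 2).
    by field; rewrite gt_eqF.
  have H1 : 1 <= normc (z - w) / (s / 2) by rewrite ler_pdivlMr ?mul1r// divr_gt0.
  have H2 : 1 <= (normc z / s) ^+ 2 by rewrite exprn_ege1// ler_pdivlMr ?mul1r.
  have fz := fM (edge_rect ez).
  rewrite (@le_trans _ _ (M * normc w ^+ 2))//.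
    by rewrite ler_wpM2r// exprn_ge0// normc_ge0.
  rewrite ler_peMr ?mulr_ge0 ?exprn_ge0 ?normc_ge0//.
  by rewrite (le_trans H1)// ler_peMr// (le_trans _ H1)//.
rewrite (le_trans (ler_wpM2l _ hb)) ?invr_ge0 ?normc_ge0//.
(* The factor [2^-1] bounds the inverse of the kernel integral, and [4 * 2 * 4 / 2 = 16]. *)
have -> : 16 * M * (normc w / s) ^+ 2 = 2^-1 *
    (4 * (2 * M * normc w ^+ 2 / s ^+ 3) * ((s - - s) + (s - - s))).
  by field; rewrite gt_eqF.
rewrite ler_wpM2r//; last by rewrite lef_pV2 ?posrE// (lt_le_trans _ k2).
apply: mulr_ge0; last by lra.
apply: mulr_ge0 => //; apply: divr_ge0; last by rewrite exprn_ge0 ?ltW.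
by apply: mulr_ge0; [exact: mulr_ge0|rewrite exprn_ge0 ?normc_ge0].
Qed.

(** A first-order expansion has only one possible linear coefficient: comparing the one with [A] and
    the one with the derivative at small real [v] identifies them. *)
Lemma quadratic_approx w : normc w <= s / 2 ->
  normc (f w - f 0 - 'D_1 f 0 * w) <= 16 * M * (normc w / s) ^+ 2.
Proof.
have sp := s0; have [A AP] := quadratic_remainder.
have r0 : rect (- s) s (- s) s 0 by rewrite /rect /=; apply/andP; split; lra.
suff -> : 'D_1 f 0 = A by exact: AP.
apply/eqP; rewrite -subr_eq0 -normc_eq0; apply/eqP; set l := 'D_1 f 0.
apply: (@eq0_of_small_multiples _ _ (1 + 16 * M / s ^+ 2)); first exact: normc_ge0.
move=> t t0; have t20 : 0 < t / 2 by rewrite divr_gt0.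
have [r rgt0 fr] := derivable_linear_approx (df r0) t20.
pose v := Num.min (t / 2) (Num.min (s / 2) (r / 2)).
have v0 : 0 < v by rewrite !lt_min !divr_gt0.
have : v <= v by [].
rewrite {2}/v !le_min => /and3P[vt vs vr].
exists (t / 2); first by apply/andP; split; lra.
have nv : normc (v%:C : C) = v by rewrite normc_real gtr0_norm.
have := AP v%:C; rewrite nv => /(_ vs) H1.
have := fr v%:C; rewrite subr0 nv => /(_ _) H2.
have {}H2 := H2 (ltac:(lra)); rewrite -/l in H2.
have : normc ((l - A) * v%:C) <= (t / 2 * (1 + 16 * M / s ^+ 2)) * v.
  have -> : (l - A) * v%:C = (f v%:C - f 0 - A * v%:C) - (f v%:C - f 0 - l * v%:C).
    by ring.
  rewrite (le_trans (normcD _ _))// normcN (le_trans (lerD H1 H2))//.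
  have -> : 16 * M * (v / s) ^+ 2 = (v * (16 * M / s ^+ 2)) * v.
    by field; rewrite gt_eqF.
  rewrite -mulrDl ler_pM2r// mulrDr mulr1 [leRHS]addrC lerD2r ler_wpM2r//.
  by rewrite divr_ge0 ?exprn_ge0 ?mulr_ge0// ltW.
by rewrite normcM nv ler_pM2r// mulrC.
Qed.

End cauchy_formula.

(** * Holomorphic functions of several variables *)

(* The norm of a complex normed module is complex-valued; [vnorm] is its real
   value. *)
HB.lock Definition vnorm (R : realType) (V : normedModType (Cplx R)) (x : V) : R :=
  complex.Re `|x|.

Section vector_norm.
Variables (R : realType) (V : normedModType (Cplx R)).
Local Notation C := (Cplx R).
Implicit Types (x y z : V) (c : C).

Lemma vnorm_def x : `|x| = (vnorm x)%:C.
Proof. by rewrite vnorm.unlock RRe_real// normr_real. Qed.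

Lemma vnorm_ge0 x : 0 <= vnorm x.
Proof. by rewrite -ler0c -vnorm_def normr_ge0. Qed.

Lemma vnormZ c x : vnorm (c *: x) = normc c * vnorm x.
Proof.
by apply: complexI; rewrite rmorphM /= -!vnorm_def -normc_def normrZ.
Qed.

Lemma vnormD x y : vnorm (x + y) <= vnorm x + vnorm y.
Proof. by rewrite -lecR rmorphD /= -!vnorm_def; exact: ler_normD. Qed.

Lemma vnormN x : vnorm (- x) = vnorm x.
Proof. by apply: complexI; rewrite -!vnorm_def normrN. Qed.

Lemma vnormB x y : vnorm (x - y) = vnorm (y - x).
Proof. by rewrite -vnormN opprB. Qed.

Lemma vnorm_distD y x z : vnorm (x - z) <= vnorm (x - y) + vnorm (y - z).
Proof. by rewrite (le_trans _ (vnormD _ _))// addrA subrK. Qed.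

Lemma vnorm0 : vnorm (0 : V) = 0.
Proof. by apply: complexI; rewrite -vnorm_def normr0. Qed.

Lemma vnorm_eq0 x : (vnorm x == 0) = (x == 0).
Proof. by rewrite -(inj_eq (@complexI R)) -vnorm_def rmorph0 normr_eq0. Qed.

Lemma vnorm_gt0 x : (0 < vnorm x) = (x != 0).
Proof. by rewrite lt_def vnorm_ge0 andbT vnorm_eq0. Qed.

Lemma nbhs_vnorm x (A : set V) :
  nbhs x A <-> exists2 e : R, 0 < e & [set y | vnorm (x - y) < e] `<=` A.
Proof.
rewrite -nbhs_ballE; split=> [[e e0 eA]|[e e0 eA]].
  have er : e \is Num.real by exact: gtr0_real.
  exists (complex.Re e) => [|w /= zw]; first by rewrite -ltcR RRe_real.
  by apply: eA; rewrite -ball_normE /ball_ /= vnorm_def -(RRe_real er) ltcR.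
exists e%:C => [|w]; first by rewrite /= ltcR.
by rewrite -ball_normE /ball_ /= vnorm_def ltcR => zw; exact: eA.
Qed.

(** On ['rV[Cplx R]_d], whose norm is the largest modulus of a coordinate, this is an open
    polydisc. *)
Definition vball x (r : R) : set V := [set y | vnorm (y - x) < r].

Lemma vball_center x (r : R) : 0 < r -> vball x r x.
Proof. by rewrite /vball /= subrr vnorm0. Qed.

Lemma nbhs_vballP x (A : set V) :
  nbhs x A <-> exists2 r : R, 0 < r & vball x r `<=` A.
Proof.
rewrite nbhs_vnorm; split => -[r r0 rA]; exists r => // y;
  by rewrite /vball /= vnormB; exact: rA.
Qed.

Lemma open_vball x (r : R) : open (vball x r).
Proof.
rewrite openE => y xy; apply/nbhs_vballP; exists (r - vnorm (y - x)).
  by rewrite subr_gt0.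
by move=> z /= yz; rewrite /vball /= (le_lt_trans (vnorm_distD y _ _))// -ltrBrDr.
Qed.

Lemma nbhs_vball x (r : R) : 0 < r -> nbhs x (vball x r).
Proof. by move=> r0; apply/nbhs_vballP; exists r. Qed.

End vector_norm.

(** * Limits of bounded complex functions along ultrafilters *)

Section ultrafilter_limit.
Variable R : realType.
Local Notation C := (Cplx R).

Definition square (c : C) (K : R) : set C :=
  [set z | `|complex.Re z - complex.Re c| <= K /\ `|complex.Im z - complex.Im c| <= K].

Lemma compact_square (c : C) (K : R) : compact (square c K).
Proof.
pose I (a : R) := `[a - K, a + K]%classic.
have -> : square c K =
    (fun p : R * R => (p.1 +i* p.2 : C)) @` (I (complex.Re c) `*` I (complex.Im c)).
  apply/seteqP; split => [[x y] [/= xK yK]|_ [[x y] [/= xK yK] <-]].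
    exists (x, y) => //; split; rewrite /I /= in_itv /=.
      by move: xK; rewrite ler_norml => /andP[? ?]; apply/andP; split; lra.
    by move: yK; rewrite ler_norml => /andP[? ?]; apply/andP; split; lra.
  rewrite /square /=; move: xK yK; rewrite /I /= !in_itv /=.
  by move=> /andP[? ?] /andP[? ?]; split; rewrite ler_norml; apply/andP; split; lra.
apply: continuous_compact; last by apply: compact_setX; exact: segment_compact.
apply: continuous_subspaceT => -[x y].
by apply: (cvg_cplx (F := nbhs (x, y))); [exact: cvg_fst|exact: cvg_snd].
Qed.

Lemma normc_square (c z : C) (K : R) : normc (z - c) <= K -> square c K z.
Proof.
move=> zK; split; apply: le_trans zK.
  by apply: le_trans (Re_le_normc (z - c)); case: (z) (c) => ? ? [].
by apply: le_trans (Im_le_normc (z - c)); case: (z) (c) => ? ? [].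
Qed.

(** Bounded values cluster in a compact square, and an ultrafilter converges to each of its cluster
    points. This takes the place of extracting subsequences. *)
Lemma ultra_bounded_cvg (I : Type) (U : set_system I) (f : I -> C) (K : R) :
  UltraFilter U -> (\forall i \near U, normc (f i) <= K) ->
  exists l : C, f @ U --> l.
Proof.
move=> UU fK; have FU : ProperFilter U by exact: ultra_proper.
have FfU : ProperFilter (f @ U) by exact: fmap_proper_filter.
have fUK : (f @ U) (square 0 K).
  by apply: filterS fK => i; rewrite -{1}(subr0 (f i)); exact: normc_square.
have [l [_ fl]] := compact_square (c := 0) (K := K) FfU fUK.
exists l => B lB.
have [//|UB] := in_ultra_setVsetC (f @^-1` B) UU.
by have [z [/=]] := fl _ _ (UB : (f @ U) (~` B)) lB.
Qed.

End ultrafilter_limit.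

(** * Estimates transferred from complex lines to normed spaces *)

Section differential_estimates.
Variables (R : realType) (V : normedModType (Cplx R)).
Local Notation C := (Cplx R).
Implicit Types (F G : V -> C) (x y z h u p : V).

Section slice.
Variables (F : V -> C) (z u : V).
Let phi (t : C) := F (z + t *: u).

(** The two difference quotients are equal as functions, so derivability and derivatives along a
    line are those of [F] in the direction [u]. *)
Let phi_quotient (t : C) :
  (fun h : C => h^-1 *: ((phi \o shift t) (h *: (1 : C)) - phi t) : C) =
  (fun h : C => h^-1 *: ((F \o shift (z + t *: u)) (h *: u) - F (z + t *: u))).
Proof.
apply/funext => h; rewrite /phi /=; congr (_ *: (F _ - _)).
by rewrite -[h *: 1]/(h * 1) mulr1 scalerDl addrCA.
Qed.

Lemma derivable_slice (t : C) : differentiable F (z + t *: u) ->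
  derivable (fun t : C => F (z + t *: u)) t 1.
Proof.
move=> dF; rewrite /derivable (phi_quotient t).
exact: (diff_derivable (v := u) dF).
Qed.

Lemma derive_slice : 'D_1 (fun t : C => F (z + t *: u)) 0 = 'D_u F z.
Proof.
rewrite /derive (phi_quotient 0) scale0r addr0.
by [].
Qed.

End slice.

Variables (F : V -> C) (z : V) (s M : R).
Hypothesis s0 : 0 < s.
Hypothesis dF : forall y, vnorm (y - z) <= 2 * s -> differentiable F y.
Hypothesis FM : forall y, vnorm (y - z) <= 2 * s -> normc (F y) <= M.

Let dFz : differentiable F z.
Proof. by apply: dF; rewrite subrr vnorm0 mulr_ge0// ltW. Qed.

Let M0 : 0 <= M.
Proof.
apply: le_trans (FM (y := z) _); first exact: normc_ge0.
by rewrite subrr vnorm0 mulr_ge0// ltW.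
Qed.

(** The one-variable estimate on the complex line through [z] in the unit direction of [h]. The
    square of half-side [s] lies in the disc of radius [2 * s], hence the radius in the hypotheses
    of the section. *)
Lemma diff_quadratic h : vnorm h <= s / 2 ->
  normc (F (z + h) - F z - 'D_h F z) <= 16 * M * (vnorm h / s) ^+ 2.
Proof.
move=> hs; have sp := s0; have [->|h0] := eqVneq h 0.
  by rewrite addr0 subrr sub0r derive0 oppr0 normc0 vnorm0 mul0r expr0n mulr0.
have vh0 : 0 < vnorm h by rewrite vnorm_gt0.
pose v : C := (vnorm h)%:C; have nv : normc v = vnorm h.
  by rewrite normc_real ger0_norm// ltW.
have v0 : v != 0 by rewrite -normc_gt0 nv.
pose u := v^-1 *: h.
have u1 : vnorm u = 1 by rewrite vnormZ normcV nv mulVf// gt_eqF.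
have hu : h = v *: u by rewrite scalerA mulfV// scale1r.
have in2 (t : C) : rect (- s) s (- s) s t -> vnorm (z + t *: u - z) <= 2 * s.
  move=> /andP[ts1 ts2]; rewrite addrAC subrr add0r vnormZ u1 mulr1.
  rewrite (le_trans (normc_le_ReIm _))// mulr_natl mulr2n.
  by rewrite lerD// ler_norml.
have dphi t : rect (- s) s (- s) s t -> derivable (fun t : C => F (z + t *: u)) t 1.
  by move=> /in2/dF; exact: derivable_slice.
have phiM t : rect (- s) s (- s) s t -> normc (F (z + t *: u)) <= M.
  by move=> /in2/FM.
have nvs : normc v <= s / 2 by rewrite nv.
have := quadratic_approx s0 dphi phiM nvs.
rewrite derive_slice scale0r addr0 -hu nv.
suff -> : 'D_h F z = 'D_u F z * v by [].
by rewrite !deriveE// {1}hu linearZ mulrC.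
Qed.

(** For [h] rescaled to norm [s / 2] the quadratic estimate bounds the derivative by
    [2 * M + 4 * M]; linearity scales back. *)
Lemma derive_bound h : normc ('D_h F z) <= 12 * M * (vnorm h / s).
Proof.
have sp := s0; have [->|h0] := eqVneq h 0.
  by rewrite derive0 normc0 vnorm0 mul0r mulr0.
have vh0 : 0 < vnorm h by rewrite vnorm_gt0.
pose k : C := (s / (2 * vnorm h))%:C.
have k0 : 0 < s / (2 * vnorm h) by rewrite divr_gt0// mulr_gt0.
have nk : normc k = s / (2 * vnorm h) by rewrite normc_real gtr0_norm.
have kh : vnorm (k *: h) = s / 2 by rewrite vnormZ nk; field; rewrite gt_eqF.
have H := @diff_quadratic (k *: h); rewrite kh in H; have {}H := H (lexx _).
have DE : 'D_(k *: h) F z = k * 'D_h F z by rewrite !deriveE// linearZ.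
have H1 : normc (F (z + k *: h)) <= M.
  by apply: FM; rewrite addrAC subrr add0r kh; lra.
have H2 : normc (F z) <= M by apply: FM; rewrite subrr vnorm0; lra.
have : normc ('D_(k *: h) F z) <= 6 * M.
  have -> : 'D_(k *: h) F z = F (z + k *: h) - F z -
    (F (z + k *: h) - F z - 'D_(k *: h) F z) by ring.
  rewrite (le_trans (normcD _ _))// normcN.
  have -> : 6 * M = (M + M) + 16 * M * (s / 2 / s) ^+ 2.
    by field; rewrite gt_eqF.
  by rewrite lerD// (le_trans (normcD _ _))// normcN lerD.
rewrite DE normcM nk => H3.
have -> : 12 * M * (vnorm h / s) = 6 * M / (s / (2 * vnorm h)).
  by field; rewrite !gt_eqF.
by rewrite ler_pdivlMr// mulrC.
Qed.

Lemma holomorphic_lipschitz h : vnorm h <= s / 2 ->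
  normc (F (z + h) - F z) <= 20 * M * (vnorm h / s).
Proof.
move=> hs; have -> : F (z + h) - F z =
  (F (z + h) - F z - 'D_h F z) + 'D_h F z by ring.
rewrite (le_trans (normcD _ _))//.
rewrite (le_trans (lerD (diff_quadratic hs) (derive_bound h)))//.
have x0 : 0 <= vnorm h / s by rewrite divr_ge0 ?vnorm_ge0// ltW.
have x1 : vnorm h / s <= 1 / 2 by rewrite ler_pdivrMr// mulrC mulrA mulr1.
(* With [x = vnorm h / s <= 1 / 2], this gives [16 * x ^ 2 + 12 * x <= 20 * x] after multiplication
   by [M]. *)
have : 0 <= M * (vnorm h / s * (1 / 2 - vnorm h / s)).
  by apply: mulr_ge0 => //; apply: mulr_ge0 => //; rewrite subr_ge0.
by move: (vnorm h / s) => x; lra.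
Qed.

End differential_estimates.

Lemma cvg_sum_seq (K : numFieldType) (V : normedModType K) (I : Type)
    (FI : set_system I) (FF : Filter FI) (J : Type) (s : seq J)
    (f : J -> I -> V) (l : J -> V) : (forall j, f j @ FI --> l j) ->
  \sum_(j <- s) f j i @[i --> FI] --> \sum_(j <- s) l j.
Proof.
move=> fl; elim: s => [|j s IH].
  by rewrite big_nil; under eq_fun do rewrite big_nil; exact: cvg_cst.
rewrite big_cons; under eq_fun do rewrite big_cons.
by apply: cvgD; [exact: fl|exact: IH].
Qed.

(** * Bounded pointwise limits of holomorphic functions *)

Section pointwise_limits.
Variable R : realType.
Local Notation C := (Cplx R).

Lemma normc_cvg_le (I : Type) (FI : set_system I) (FF : ProperFilter FI)
    (f : I -> C) (l : C) (K : R) :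
  f @ FI --> l -> (\forall i \near FI, normc (f i) <= K) -> normc l <= K.
Proof.
move=> /cvgcP fl fK; apply/ler_addgt0Pr => e e0.
have [i [il iK]] := filter_ex (filterI (fl _ e0) fK).
rewrite -(subrK (f i) l) (le_trans (normcD _ _))// addrC lerD//.
exact: ltW.
Qed.

(** An increment of quadratic order is negligible against [h], so the zero map is the
    differential. *)
Lemma differentiable_flat (V : normedModType C) (G : V -> C) (z : V) (K r : R) :
  0 < r -> (forall h, vnorm h < r -> normc (G (z + h) - G z) <= K * vnorm h ^+ 2) ->
  differentiable G z.
Proof.
move=> r0 GK.
have Go : G \o shift z = cst (G z) + (\0 : {linear V -> C}) +o_ 0 id.
  apply/eqaddoP => e e0; have er : e \is Num.real by exact: gtr0_real.
  have e'0 : 0 < complex.Re e by rewrite -ltcR RRe_real.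
  set e' := complex.Re e in e'0; have -> : e = e'%:C by rewrite RRe_real.
  have K1 : 0 < `|K| + 1 by rewrite ltr_wpDl.
  apply/nbhs_vballP; exists (Num.min r (e' / (`|K| + 1))).
    by rewrite lt_min r0 divr_gt0.
  move=> h; rewrite /vball /= subr0 lt_min => /andP[hr he].
  rewrite -[leLHS]/(`|G (h + z) - (G z + 0)|) addr0 [h + z]addrC.
  rewrite normc_def vnorm_def -rmorphM /= lecR.
  rewrite (le_trans (GK _ hr))// expr2 mulrA ler_wpM2r ?vnorm_ge0//.
  rewrite (@le_trans _ _ (`|K| * vnorm h))//.
    by rewrite ler_wpM2r ?vnorm_ge0// ler_norm.
  rewrite (@le_trans _ _ ((`|K| + 1) * vnorm h))//.
    by rewrite ler_wpM2r ?vnorm_ge0// lerDl.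
  by rewrite mulrC -ler_pdivlMr// ltW.
have c0 : continuous (\0 : {linear V -> C}) by move=> x; exact: cst_continuous.
by apply/diff_locallyP; rewrite (diff_unique c0 Go).
Qed.

Variable d : nat.
Local Notation Cd := 'rV[C]_d.
Implicit Types (F : Cd -> C) (y z h p : Cd).

(** Subtracting the linear form with coefficients [c] reduces this to [differentiable_flat]. *)
Lemma differentiable_quadratic (G : Cd -> C) z (c : 'I_d -> C) (K r : R) : 0 < r ->
  (forall h, vnorm h < r ->
    normc (G (z + h) - G z - \sum_(j < d) h 0 j * c j) <= K * vnorm h ^+ 2) ->
  differentiable G z.
Proof.
move=> r0 GK; pose L : Cd -> C := \sum_(j < d) (c j \*: (fun h : Cd => h 0 j)).
have LE h : L h = \sum_(j < d) h 0 j * c j.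
  rewrite /L fct_sumE; apply: eq_bigr => j _.
  by rewrite /= -[_ *: _]/(_ * _) mulrC.
have dL : differentiable L z.
  apply: differentiable_sum => j; apply: differentiableZ.
  exact: differentiable_coord.
have -> : G = (G - L) + L by apply/funext => y; rewrite /= subrK.
apply: differentiableD dL; apply: (differentiable_flat (K := K) r0) => h hr.
have -> : (G - L) (z + h) - (G - L) z = G (z + h) - G z - L h.
  rewrite -[LHS]/(G (z + h) - L (z + h) - (G z - L z)).
  have -> : L (z + h) = L z + L h.
    rewrite !LE -big_split /=; apply: eq_bigr => j _.
    by rewrite mxE mulrDl.
  by ring.
by rewrite LE; exact: GK.
Qed.

Lemma diff_coord_sum F z h : differentiable F z ->
  'D_h F z = \sum_(j < d) h 0 j * 'D_(delta_mx 0 j) F z.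
Proof.
move=> dF; rewrite deriveE// {1}(row_sum_delta h) linear_sum.
by apply: eq_bigr => j _; rewrite linearZ /= deriveE.
Qed.

Section limit.
Variables (I : Type) (FI : set_system I) (FF : ProperFilter FI).
Variables (F : I -> Cd -> C) (G : Cd -> C) (p : Cd) (r M : R).
Hypothesis FM : \forall i \near FI, forall y, vball p r y ->
  differentiable (F i) y /\ normc (F i y) <= M.
Hypothesis FG : forall y, vball p r y -> F i y @[i --> FI] --> G y.

Let radius y : vball p r y ->
  exists2 s : R, 0 < s & forall x, vnorm (x - y) <= 2 * s -> vball p r x.
Proof.
(* Twice this [s] is half of the distance left to the sphere, so the closed ball of radius [2 * s]
   stays inside. *)
move=> py; exists ((r - vnorm (y - p)) / 4); first by rewrite divr_gt0 ?subr_gt0.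
move=> x xy; rewrite /vball /= (le_lt_trans (vnorm_distD y _ _))//.
by move: (py); rewrite /vball /=; lra.
Qed.

Lemma pointwise_limit_bound y : vball p r y -> normc (G y) <= M.
Proof.
move=> py; apply: (normc_cvg_le FF (FG py)).
by apply: filterS FM => i /(_ _ py)[].
Qed.

(* Along an ultrafilter the bounded partial derivatives converge, and the
   quadratic remainder estimate, uniform in the family, passes to the limit. *)
Lemma pointwise_limit_differentiable y : vball p r y -> differentiable G y.
Proof.
move=> py; have [s s0 sP] := radius py.
have [U [UU FU]] := ultraFilterLemma FF.
have PU : ProperFilter U by exact: ultra_proper.
have UM : \forall i \near U, forall y, vball p r y ->
  differentiable (F i) y /\ normc (F i y) <= M by exact: FU.
have UG x : vball p r x -> F i x @[i --> U] --> G x.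
  by move=> /FG FGx; apply: cvg_trans FGx; exact: cvg_app.
have cvD j : exists l : C, 'D_(delta_mx 0 j) (F i) y @[i --> U] --> l.
  apply: (@ultra_bounded_cvg _ _ _ _ (12 * M * (vnorm (delta_mx 0 j : Cd) / s))).
  apply: filterS UM => i iM; apply: (derive_bound s0) => x /sP /iM[dx bx].
    exact: dx.
  exact: bx.
have /choice[c cP] := cvD.
apply: (@differentiable_quadratic _ _ c (16 * M / s ^+ 2) (s / 2)).
  by rewrite divr_gt0.
move=> h hs.
have yh : vball p r (y + h).
  by apply: sP; rewrite addrAC subrr add0r; lra.
have -> : 16 * M / s ^+ 2 * vnorm h ^+ 2 = 16 * M * (vnorm h / s) ^+ 2.
  by field; rewrite gt_eqF.
have lim : F i (y + h) - F i y - \sum_(j < d) h 0 j * 'D_(delta_mx 0 j) (F i) y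
    @[i --> U] --> G (y + h) - G y - \sum_(j < d) h 0 j * c j.
  apply: cvgB; first by apply: cvgB; exact: UG.
  by apply: cvg_sum_seq => j; apply: cvgM; [exact: cvg_cst|exact: cP].
apply: (normc_cvg_le PU lim); apply: filterS UM => i iM.
have dFi : differentiable (F i) y by case: (iM _ py).
rewrite -(diff_coord_sum h dFi).
apply: (diff_quadratic s0 _ _ (ltW hs)) => x /sP/iM[dx bx]; first exact: dx.
exact: bx.
Qed.

(** Derivatives are compared through increments with one small step [t]: the remainders are of order
    [t ^ 2] uniformly in the family, and for fixed [t] the increments converge along [FI] itself. *)
Lemma pointwise_limit_derive y h : vball p r y ->
  'D_h (F i) y @[i --> FI] --> 'D_h G y.
Proof.
move=> py; have [s s0 sP] := radius py.
have [->|h0] := eqVneq h 0.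
  rewrite derive0; under eq_fun do rewrite derive0.
  exact: cvg_cst.
have vh0 : 0 < vnorm h by rewrite vnorm_gt0.
apply/cvgcP => e e0.
(* The two remainders add up to [t * (t * B)]; choosing [t <= e / (2 * B1)] brings this under
   [t * (e / 2)], and [B1] is positive whatever [B] is. *)
pose B := 32 * M * (vnorm h / s) ^+ 2; pose B1 := `|B| + 1.
have B10 : 0 < B1 by rewrite ltr_wpDl.
pose t := Num.min (s / (2 * vnorm h)) (e / (2 * B1)).
have t0 : 0 < t by rewrite lt_min !divr_gt0 ?mulr_gt0.
have ts : t * vnorm h <= s / 2.
  have : t <= s / (2 * vnorm h) by rewrite ge_min lexx.
  rewrite ler_pdivlMr ?mulr_gt0// => H.
  by rewrite ler_pdivlMr//; apply: le_trans H; lra.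
have tB : t * B1 <= e / 2.
  have : t <= e / (2 * B1) by rewrite ge_min lexx orbT.
  rewrite ler_pdivlMr ?mulr_gt0// => H.
  by rewrite ler_pdivlMr//; apply: le_trans H; lra.
have nt : normc (t%:C : C) = t by rewrite normc_real gtr0_norm.
have vth : vnorm (t%:C *: h) = t * vnorm h by rewrite vnormZ nt.
have yth : vball p r (y + t%:C *: h).
  by apply: sP; rewrite addrAC subrr add0r vth; lra.
have et : 0 < t * e / 4 by rewrite divr_gt0// mulr_gt0.
have /cvgcP/(_ _ et) c1 := FG yth; have /cvgcP/(_ _ et) c2 := FG py.
apply: filterS3 c1 c2 FM => i i1 i2 iM.
have GM x : vball p r x -> differentiable G x /\ normc (G x) <= M.
  by move=> px; split;
    [exact: pointwise_limit_differentiable|exact: pointwise_limit_bound].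
have qF : normc (F i (y + t%:C *: h) - F i y - 'D_(t%:C *: h) (F i) y) <=
    16 * M * (vnorm (t%:C *: h) / s) ^+ 2.
  have vs : vnorm (t%:C *: h) <= s / 2 by rewrite vth.
  apply: (diff_quadratic s0 _ _ vs) => x /sP/iM[dx bx]; first exact: dx.
  exact: bx.
have qG : normc (G (y + t%:C *: h) - G y - 'D_(t%:C *: h) G y) <=
    16 * M * (vnorm (t%:C *: h) / s) ^+ 2.
  have vs : vnorm (t%:C *: h) <= s / 2 by rewrite vth.
  apply: (diff_quadratic s0 _ _ vs) => x /sP/GM[dx bx]; first exact: dx.
  exact: bx.
have dFi : differentiable (F i) y by case: (iM _ py).
have dGy : differentiable G y by case: (GM _ py).
have DZ (H : Cd -> C) : differentiable H y -> 'D_(t%:C *: h) H y = t%:C * 'D_h H y.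
  by move=> dH; rewrite !deriveE// linearZ.
rewrite (DZ _ dFi) in qF; rewrite (DZ _ dGy) in qG.
rewrite -(ltr_pM2l t0) -{1}nt -normcM.
set a := F i (y + _) in i1 qF; set b := F i y in i2 qF.
set a' := G (y + _) in i1 qG; set b' := G y in i2 qG.
(* The difference of the derivatives, times the step, is the difference of the remainders plus that
   of the increments. *)
have alg (k u v u' v' x x' : C) : k * (x' - x) =
    (u - v - k * x) - (u' - v' - k * x') + ((u' - u) - (v' - v)) by ring.
rewrite (alg _ a b a' b').
apply: (le_lt_trans (normcD _ _)).
have H1 : normc (a - b - t%:C * 'D_h (F i) y - (a' - b' - t%:C * 'D_h G y)) <=
    t * (e / 2).
  rewrite (le_trans (normcD _ _))// normcN (le_trans (lerD qF qG))//.
  have -> : 16 * M * (vnorm (t%:C *: h) / s) ^+ 2 +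
      16 * M * (vnorm (t%:C *: h) / s) ^+ 2 = t * (t * B).
    by rewrite vth /B; field; rewrite gt_eqF.
  rewrite ler_pM2l//; apply: le_trans tB; rewrite ler_pM2l// /B1.
  by rewrite (le_trans (ler_norm _))// lerDl.
have H2 : normc (a' - a - (b' - b)) < t * (e / 2).
  rewrite (le_lt_trans (normcD _ _))// normcN.
  have -> : t * (e / 2) = t * e / 4 + t * e / 4 by field.
  exact: ltrD.
have -> : t * e = t * (e / 2) + t * (e / 2) by field.
exact: ler_ltD.
Qed.

End limit.

End pointwise_limits.

(** * Holomorphy of directional derivatives *)

Section partial_derivatives.
Variables (R : realType) (d : nat).
Local Notation C := (Cplx R).
Local Notation Cd := 'rV[C]_d.
Implicit Types (U Omega : set Cd) (F f g : Cd -> C) (y z v : Cd).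

Lemma derive_eq_on U f g v z : open U -> U z -> {in U, f =1 g} ->
  'D_v f z = 'D_v g z.
Proof.
move=> oU Uz fg; apply: near_eq_derive.
by apply: filterS (open_nbhs_nbhs (conj oU Uz)) => y Uy; apply: fg; rewrite inE.
Qed.

Lemma open_vball_sub U z : open U -> U z ->
  exists2 r : R, 0 < r & vball z r `<=` U.
Proof. by move=> oU Uz; apply/nbhs_vballP/open_nbhs_nbhs. Qed.

Lemma locally_bounded F z : {for z, continuous F} ->
  exists2 r : R, 0 < r & forall y, vball z r y -> normc (F y) <= normc (F z) + 1.
Proof.
move=> /(cvgcP (F := nbhs z))/(_ _ ltr01)/nbhs_vballP[r r0 rP]; exists r => // y.
move=> /rP/= Fyz; have := normcD (F y - F z) (F z).
by rewrite subrK normcB; lra.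
Qed.

(* Near z the difference quotients are holomorphic and, by the Lipschitz
   estimate, uniformly bounded. *)
Lemma holomorphic_derive U F v : open U -> holomorphic_on U F ->
  holomorphic_on U ('D_v F).
Proof.
move=> oU hF z Uz; have [r1 r10 r1U] := open_vball_sub oU Uz.
have [r2 r20 FM] := locally_bounded (differentiable_continuous (hF _ Uz)).
set M := normc (F z) + 1 in FM.
(* This leaves room for points within [2 * s] of a point of [vball z s], as the Lipschitz estimate
   requires. *)
pose s := Num.min r1 r2 / 6.
have s0 : 0 < s by rewrite divr_gt0// lt_min r10.
have s1 : 6 * s <= r1 by rewrite /s mulrC divfK// ge_min lexx.
have s2 : 6 * s <= r2 by rewrite /s mulrC divfK// ge_min lexx orbT.
have dF y : vball z (6 * s) y -> differentiable F y.
  by move=> zy; apply/hF/r1U; apply: lt_le_trans s1.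
have {}FM y : vball z (6 * s) y -> normc (F y) <= M.
  by move=> zy; apply: FM; apply: lt_le_trans s2.
pose q (h : C) y : C := h^-1 *: ((F \o shift y) (h *: v) - F y).
have v1 : 0 < vnorm v + 1 by rewrite ltr_wpDl ?vnorm_ge0.
have M0 : 0 <= M by rewrite addr_ge0 ?normc_ge0.
apply: (@pointwise_limit_differentiable R d C 0^' _ q ('D_v F) z s
   (20 * M * (vnorm v / s))); last exact: vball_center.
  apply/(nbhs_normc (0 : C)).
  (* Keeps [vnorm (h *: v)] below [s / 2]; the added 1 allows [v = 0]. *)
  exists (s / 2 / (vnorm v + 1)); first exact: divr_gt0 (divr_gt0 s0 (ltr0Sn _ 1)) v1.
  move=> h hs0 h0 y zy; have hs : normc h * (vnorm v + 1) < s / 2.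
    by rewrite -ltr_pdivlMr// -normcN -(sub0r h); exact: hs0.
  have hv : vnorm (h *: v) <= s / 2.
    rewrite vnormZ (le_trans _ (ltW hs))// ler_wpM2l ?normc_ge0//.
    by rewrite lerDl.
  have yz : vnorm (y - z) < s := zy.
  split; last first.
    have := @holomorphic_lipschitz R Cd F y s M s0.
    have H x : vnorm (x - y) <= 2 * s -> vball z (6 * s) x.
      by move=> xy; have := vnorm_distD y x z; rewrite /vball /=; lra.
    move=> /(_ (fun x xy => dF _ (H x xy)) (fun x xy => FM _ (H x xy)) _ hv).
    rewrite vnormZ => L.
    rewrite (_ : q h y = h^-1 * (F (y + h *: v) - F y)); last first.
      by rewrite /q /= [h *: v + y]addrC.
    rewrite normcM normcV.
    have nh0 : 0 < normc h by rewrite normc_gt0.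
    rewrite mulrC ler_pdivrMr// (le_trans L)//.
    by rewrite le_eqVlt; apply/orP; left; apply/eqP; field; rewrite gt_eqF.
  have d1 : differentiable F y by apply: dF; rewrite /vball /=; lra.
  have d2 : differentiable (F \o shift (h *: v)) y.
    apply: differentiable_comp.
      apply: (@differentiableD _ _ _ id (cst (h *: v))); first exact: ex_diff.
      exact: differentiable_cst.
    apply: dF; rewrite /vball /=.
    by have := vnormD (h *: v) (y - z); rewrite addrA (addrC _ y); lra.
  have -> : q h = h^-1 \*: ((F \o shift (h *: v)) - F).
    apply/funext => x; rewrite -[RHS]/(h^-1 *: (F (x + h *: v) - F x)).
    by rewrite /q /= [h *: v + x]addrC.
  exact: (differentiableZ _ (differentiableB d2 d1)).
move=> y zy; apply: (diff_derivable (v := v)).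
by apply: dF; move: zy; rewrite /vball /=; lra.
Qed.

End partial_derivatives.

(** * Mixed partial derivatives and families of holomorphic functions *)

Section mixed_partials.
Variables (R : realType) (d : nat).
Local Notation C := (Cplx R).
Local Notation Cd := 'rV[C]_d.
Implicit Types (U Omega : set Cd) (F f g : Cd -> C) (y z v : Cd) (k : 'I_d -> nat).
Variable T : (Cd -> C) -> (Cd -> C).
Hypothesis T_id_or_mixed : id_or_mixed_partial T.

(** What is stable under directional derivatives is stable under [T]. The predicate bears on indexed
    families so as to cover relations between several functions and families parametrized by [X]. *)
Lemma id_or_mixed_partial_ind (I : Type) (P : (I -> Cd -> C) -> Prop) :
  (forall Phi v, P Phi -> P (fun i => 'D_v (Phi i))) ->
  forall Phi, P Phi -> P (fun i => T (Phi i)).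
Proof.
move=> PD Phi PPhi; case: T_id_or_mixed => [->//|[k ->]].
rewrite /mixed_partial; elim: (enum _) => [//|j s IH] /=.
by elim: (k j) => [//|n IHn] /=; exact: PD.
Qed.

Lemma holomorphic_mixed_partial U F :
  open U -> holomorphic_on U F -> holomorphic_on U (T F).
Proof.
move=> oU hF.
apply: (@id_or_mixed_partial_ind unit
  (fun Phi => holomorphic_on U (Phi tt)) _ (fun=> F)) => // Phi v.
exact: holomorphic_derive.
Qed.

Lemma mixed_partial_eq_on U f g : open U -> {in U, f =1 g} ->
  {in U, T f =1 T g}.
Proof.
move=> oU fg.
apply: (@id_or_mixed_partial_ind bool
  (fun Phi => {in U, Phi true =1 Phi false}) _ (fun b => if b then f else g)).
  by move=> Phi v PU z /set_mem Uz; exact: derive_eq_on Uz PU.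
by [].
Qed.

(** The linear relation is assumed on [U] only because [evD] and [evZ] hold on [Omega] only. *)
Lemma mixed_partial_linear U (F f g : Cd -> C) (a : C) : open U ->
  holomorphic_on U F -> holomorphic_on U f -> holomorphic_on U g ->
  {in U, forall z, F z = f z + a * g z} ->
  {in U, forall z, T F z = T f z + a * T g z}.
Proof.
move=> oU hF hf hg Ffg.
(* Holomorphy of the three functions is carried through the induction since linearity of the next
   derivative depends on it. [None], [Some true] and [Some false] stand for [F], [f] and [g]. *)
pose P (Phi : option bool -> Cd -> C) :=
  (forall i, holomorphic_on U (Phi i)) /\
  {in U, forall z, Phi None z = Phi (Some true) z + a * Phi (Some false) z}.
pose Phi0 (i : option bool) := if i is Some b then if b then f else g else F.
suff [] : P (fun i => T (Phi0 i)) by [].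
apply: id_or_mixed_partial_ind; last by split=> // -[[]|].
move=> Phi v [hP PE]; split=> [i|z /set_mem Uz]; first exact: holomorphic_derive.
rewrite (derive_eq_on (g := Phi (Some true) + a \*: Phi (Some false)) v oU Uz PE).
have d1 := diff_derivable (v := v) (hP (Some true) _ Uz).
have d2 := diff_derivable (v := v) (hP (Some false) _ Uz).
have d3 : derivable (a \*: Phi (Some false)) z v by exact: derivableZ.
by rewrite (deriveD d1 d3) deriveZ.
Qed.

Section holomorphic_family.
Variables (X : topologicalType) (Omega : set Cd).
Hypothesis oO : open Omega.

(* Joint local boundedness in [f] and [z] is what makes this class stable under
   partial derivatives. *)
Definition normal_family (Phi : X -> Cd -> C) :=
  [/\ forall f : X, holomorphic_on Omega (Phi f),
      forall (f : X) z, Omega z -> Phi g z @[g --> f] --> Phi f z &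
      forall (f : X) z, Omega z -> exists r M : R, 0 < r /\
        \forall g \near f, forall y, vball z r y -> normc (Phi g y) <= M].

(** Continuity in [f] is [pointwise_limit_derive] along the neighbourhoods of [f]; the local bound
    is [derive_bound] on a smaller ball. *)
Lemma normal_family_derive (Phi : X -> Cd -> C) v :
  normal_family Phi -> normal_family (fun f : X => 'D_v (Phi f)).
Proof.
move=> [hP cP bP]; split=> [f|f z Oz|f z Oz].
- exact: holomorphic_derive.
- have [r1 [M [r10 fM]]] := bP f _ Oz; have [r2 r20 r2O] := open_vball_sub oO Oz.
  pose r := Num.min r1 r2; have r0 : 0 < r by rewrite lt_min r10.
  have rO y : vball z r y -> Omega y.
    by move=> zy; apply: r2O; apply: (lt_le_trans zy); rewrite ge_min lexx orbT.
  apply: (@pointwise_limit_derive R d X (nbhs f) _ Phi (Phi f) z r M).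
  + apply: filterS fM => g gM y zy; split; first exact/hP/rO.
    by apply: gM; apply: (lt_le_trans zy); rewrite ge_min lexx.
  + by move=> y /rO; exact: cP.
  + exact: vball_center.
- have [r1 [M [r10 fM]]] := bP f _ Oz; have [r2 r20 r2O] := open_vball_sub oO Oz.
  pose s := Num.min r1 r2 / 4.
  have s0 : 0 < s by rewrite divr_gt0// lt_min r10.
  have s1 : 4 * s <= r1 by rewrite /s mulrC divfK// ge_min lexx.
  have s2 : 4 * s <= r2 by rewrite /s mulrC divfK// ge_min lexx orbT.
  exists s, (12 * M * (vnorm v / s)); split => //.
  apply: filterS fM => g gM y zy.
  have H x : vnorm (x - y) <= 2 * s -> vball z (4 * s) x.
    by move: zy; rewrite /vball /=; have := vnorm_distD y x z; lra.
  apply: (derive_bound s0) => x /H zx.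
    by apply/hP/r2O; apply: lt_le_trans s2.
  by apply: gM; apply: lt_le_trans s1.
Qed.

Lemma normal_family_mixed_partial (Phi : X -> Cd -> C) :
  normal_family Phi -> normal_family (fun f : X => T (Phi f)).
Proof.
move=> nP; apply: (@id_or_mixed_partial_ind X normal_family _ Phi nP) => Psi v.
exact: normal_family_derive.
Qed.

End holomorphic_family.

End mixed_partials.

Section coordinates.
Variables (R : realType) (d : nat).
Implicit Types x : 'rV[Cplx R]_d.

Lemma normc_coord x i : normc (x 0 i) <= vnorm x.
Proof.
apply/ler_addgt0Pr => e e0.
have : ball (0 : 'rV[Cplx R]_d) (vnorm x + e)%:C x.
  by rewrite -ball_normE /ball_ /= sub0r normrN vnorm_def ltcR ltrDl.
move=> [_ /(_ 0 i)]; rewrite mxE -ball_normE /ball_ /= sub0r normrN.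
by rewrite normc_def ltcR => /ltW.
Qed.

Lemma vnorm_le x (K : R) : 0 <= K -> (forall i, normc (x 0 i) <= K) ->
  vnorm x <= K.
Proof.
move=> K0 xK; have [->|x0] := eqVneq x 0; first by rewrite vnorm0.
have : mx_norm x != 0 by rewrite -[mx_norm x]/(`|x|) normr_eq0.
move=> /mx_norm_neq0[[i j]] /=; rewrite (ord1 i) => xE.
by rewrite -lecR -vnorm_def -[leLHS]/(mx_norm x) xE normc_def lecR.
Qed.

End coordinates.

(** * Evaluation of the elements of [X] *)

Section evaluation.
Variables (R : realType) (d : nat) (Omega : set 'rV[Cplx R]_d).
Local Notation C := (Cplx R).
Local Notation Cd := 'rV[C]_d.
Variables (X : topologicalLmodType C) (ev : X -> Cd -> C).
Hypothesis oO : open Omega.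
Hypothesis hX : holomorphic_function_space Omega ev.
Variable dist : X -> X -> R.
Hypothesis mdist : is_metric dist.
Hypothesis idist : induces_topology dist.
Hypothesis cX : cvg_uniform_on_compacts Omega ev.

Lemma dist_cvg (u : nat -> X) (f : X) :
  (forall n, dist f (u n) < n.+1%:R^-1) -> u @ \oo --> f.
Proof.
move=> uf A /idist[e e0 eA].
have [n _ nP] := near_infty_natSinv_lt (PosNum e0).
exists n => // m nm; apply: eA; apply: (lt_trans (uf m)).
exact: nP.
Qed.

(** Uniform convergence is assumed for sequences. If no ball around [f] worked, offending elements
    at distance below [1 / (n + 1)] would form a sequence converging to [f]. *)
Lemma near_close_on_compact (K : set Cd) (f : X) (e : R) : 0 < e ->
  compact K -> K `<=` Omega ->
  \forall g \near f, forall y, K y -> normc (ev f y - ev g y) <= e.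
Proof.
move=> e0 cK KO; apply/idist; apply: contrapT => H.
have /choice[u uP] : forall n : nat, exists g, dist f g < n.+1%:R^-1 /\
    ~ (forall y, K y -> normc (ev f y - ev g y) <= e).
  move=> n.
  apply: contrapT => Hn; apply: H; exists n.+1%:R^-1; first by rewrite invr_gt0.
  by move=> g /= fg; apply: contrapT => ng; apply: Hn; exists g.
have uf : u @ \oo --> f by apply: dist_cvg => n; case: (uP n).
have nb : nbhs (ev f : {uniform` K -> C})
    [set g : Cd -> C | forall y, K y -> normc (ev f y - g y) <= e].
  apply/uniform_nbhs; exists [set p : C * C | `|p.1 - p.2| < e%:C]; split.
    by rewrite -entourage_ballE; exists e%:C; rewrite //= ltcR.
  by move=> g /= gE y Ky; have := gE _ Ky; rewrite normc_def ltcR => /ltW.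
have [n _ /(_ n (leqnn n)) nP] := cX uf cK KO nb.
by case: (uP n) => _; apply.
Qed.

(** For the joint bound, elements near [f] stay within 1 of [ev f] on a compact neighbourhood of
    [z], where [ev f] itself is bounded by its modulus at [z] plus 1. *)
Lemma normal_family_ev : normal_family Omega ev.
Proof.
split=> [f|f z Oz|f z Oz].
- exact: ev_holomorphic hX f.
- apply/(cvgcP (F := nbhs f)) => e e0; have e20 : 0 < e / 2 by rewrite divr_gt0.
  have := @near_close_on_compact [set z] f _ e20 (@compact_set1 _ z).
  have zO : [set z] `<=` Omega by move=> y ->.
  move=> /(_ zO); apply: filterS => g /(_ z erefl) H.
  by rewrite (le_lt_trans H)// ltr_pdivrMr// mulr_natr mulr2n ltrDl.
- have [r1 r10 r1O] := open_vball_sub oO Oz.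
  have hf := ev_holomorphic hX f Oz.
  have [r2 r20 fM] := locally_bounded (differentiable_continuous hf).
  pose r := Num.min r1 r2; have r0 : 0 < r by rewrite lt_min r10.
  (* A compact product of squares between [vball z (r / 4)] and [vball z r]. *)
  pose K : set Cd := [set y | forall i, square (z 0 i) (r / 4) (y 0 i)].
  have cK : compact K.
    apply: (@rV_compact C d (fun i => square (z 0 i) (r / 4))) => i.
    exact: compact_square.
  have Kr y : K y -> vball z r y.
    move=> Ky; rewrite /vball /= (@le_lt_trans _ _ (r / 2))//; last by lra.
    apply: vnorm_le => [|i]; first by lra.
    rewrite !mxE (le_trans (normc_le_ReIm _))//; have [] := Ky i.
    by case: (y 0 i) (z 0 i) => [a b] [a' b'] /=; lra.
  have KO : K `<=` Omega.
    by move=> y /Kr zy; apply: r1O; apply: (lt_le_trans zy); rewrite ge_min lexx.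
  exists (r / 4), (normc (ev f z) + 2); split; first by rewrite divr_gt0.
  have := @near_close_on_compact K f 1 ltr01 cK KO.
  apply: filterS => g gK y zy.
  have Ky : K y.
    move=> i; apply: normc_square; apply: ltW; apply: le_lt_trans zy.
    by have := normc_coord (y - z) i; rewrite !mxE.
  have fy : normc (ev f y) <= normc (ev f z) + 1.
    by apply: fM; apply: (lt_le_trans (Kr _ Ky)); rewrite ge_min lexx orbT.
  have := normcD (ev g y - ev f y) (ev f y); rewrite subrK normcB.
  by have := gK _ Ky; lra.
Qed.

End evaluation.

(** * Components and boundary cells *)

Section star_shaped.
Variables (R : realType) (V : normedModType (Cplx R)).
Implicit Types (A B : set V) (x y z w : V).

Lemma star_shaped_connected A c :
  (forall z (t : R), A z -> 0 <= t <= 1 -> A (c + t%:C *: (z - c))) -> connected A.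
Proof.
move=> starA; pose seg z := (fun t : R => c + t%:C *: (z - c)) @` `[0, 1]%classic.
have -> : A = \bigcup_(z in A) seg z.
  apply/seteqP; split => [z Az|_ [z Az] [t /= t01 <-]].
    exists z => //; exists 1; rewrite /= ?in_itv /= ?lexx ?ler01//.
    by rewrite scale1r addrC subrK.
  by apply: starA => //; move: t01; rewrite in_itv.
apply: bigcup_connected.
  exists c => z Az; exists 0; rewrite /= ?in_itv /= ?lexx ?ler01//.
  by rewrite scale0r addr0.
move=> z Az; apply: connected_continuous_connected; first exact: segment_connected.
apply: continuous_subspaceT => t.
apply: (cvgD (F := nbhs t)); first exact: cvg_cst.
apply: (cvgZl (F := nbhs t)).
by apply: (cvg_cplx (F := nbhs t)); [exact: cvg_id|exact: cvg_cst].
Qed.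

Lemma connected_vball x (r : R) : connected (vball x r).
Proof.
apply: (@star_shaped_connected _ x) => z t; rewrite /vball /= => zr /andP[t0 t1].
rewrite addrAC subrr add0r vnormZ normc_real ger0_norm//.
by apply: le_lt_trans zr; rewrite ler_piMl ?vnorm_ge0.
Qed.

Lemma open_component A x : open A -> open (connected_component A x).
Proof.
move=> oA; rewrite openE => y Axy.
have Ay : A y := connected_component_sub Axy.
have [r r0 rA] : exists2 r : R, 0 < r & vball y r `<=` A.
  exact/nbhs_vballP/open_nbhs_nbhs.
apply/nbhs_vballP; exists r => // z yz; apply: connected_component_trans Axy _.
by apply: (connected_component_max _ rA (connected_vball (r := r))) => //;
  exact: vball_center.
Qed.

Lemma component_sub A B x y : A `<=` B -> connected_component B x y ->
  connected_component A y `<=` connected_component B x.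
Proof.
move=> AB Bxy z [D [Dy DA cD] Dz]; apply: connected_component_trans Bxy _.
by exists D => //; split => //; exact: subset_trans AB.
Qed.

Lemma nbhs_component A x : open A -> A x -> nbhs x (connected_component A x).
Proof.
move=> oA Ax; apply: open_nbhs_nbhs; split; first exact: open_component.
exact: connected_component_refl.
Qed.

End star_shaped.

(** * Euclidean balls and components reaching the boundary *)

Section euclidean_balls.
Variables (R : realType) (d : nat).
Local Notation C := (Cplx R).
Local Notation Cd := 'rV[C]_d.
Implicit Types (z zeta w : Cd).

Definition sqnorm z : R := \sum_(i < d) normc (z 0 i) ^+ 2.

Lemma eballE zeta (eps : R) : 0 < eps ->
  eball zeta eps = [set z | sqnorm (z - zeta) < eps ^+ 2].
Proof.
move=> e0; apply/seteqP.
have sq z : \sum_(i < d) `|z 0 i| ^+ 2 = (sqnorm z)%:C :> C.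
  rewrite /sqnorm rmorph_sum /=; apply: eq_bigr => i _.
  by rewrite rmorphXn /= -normc_def.
have s0 z : 0 <= sqnorm z by apply: sumr_ge0 => i _; rewrite exprn_ge0 ?normc_ge0.
have H z : (enorm (z - zeta) < eps%:C) = (sqnorm (z - zeta) < eps ^+ 2).
  rewrite /enorm sq -[LHS](ltr_pXn2r (ltn0Sn 1)) ?nnegrE ?sqrtC_ge0
    ?ler0c ?s0 ?(ltW e0)//.
  by rewrite sqrtCK -rmorphXn /= ltcR.
by split=> z ze; [exact: etrans (esym (H z)) ze|exact: etrans (H z) ze].
Qed.

Lemma vball_eball zeta (eps : R) : 0 < eps ->
  exists2 r : R, 0 < r & vball zeta r `<=` eball zeta eps.
Proof.
(* For a sup norm [x <= 1] the sum of squares is at most [d * x]; dividing by [d + 1] also covers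
   [d = 0]. *)
move=> e0; exists (Num.min 1 (eps ^+ 2 / d.+1%:R)).
  by rewrite lt_min ltr01 divr_gt0// exprn_gt0.
move=> z; rewrite /vball /= lt_min eballE// => /andP[z1].
rewrite ltr_pdivlMr// => ze /=; apply: le_lt_trans ze.
rewrite /sqnorm; apply: (@le_trans _ _ (\sum_(i < d) vnorm (z - zeta))).
  apply: ler_sum => i _; have := normc_coord (z - zeta) i.
  have := normc_ge0 ((z - zeta) 0 i).
  move: (normc _) (vnorm _) z1 => x y y1 x0 xy.
  by rewrite expr2; nra.
by rewrite sumr_const card_ord -[leLHS]mulr_natr ler_wpM2l ?vnorm_ge0// ler_nat.
Qed.

Lemma eball_vball zeta (eps : R) : 0 < eps -> eball zeta eps `<=` vball zeta eps.
Proof.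
move=> e0 z; rewrite eballE// /vball /= => ze.
have s0 : 0 <= Num.sqrt (sqnorm (z - zeta)) by exact: sqrtr_ge0.
have sg0 : 0 <= sqnorm (z - zeta).
  by apply: sumr_ge0 => i _; rewrite exprn_ge0 ?normc_ge0.
apply: (@le_lt_trans _ _ (Num.sqrt (sqnorm (z - zeta)))).
  apply: vnorm_le => // i.
  rewrite -(ger0_norm (normc_ge0 _)) -sqrtr_sqr ler_wsqrtr//.
  rewrite /sqnorm (bigD1 i)//= lerDl; apply: sumr_ge0 => j _.
  by rewrite exprn_ge0 ?normc_ge0.
by rewrite -(ger0_norm (ltW e0)) -sqrtr_sqr ltr_sqrt// exprn_gt0.
Qed.

Lemma eball_center zeta (eps : R) : 0 < eps -> eball zeta eps zeta.
Proof.
by move=> e0; have [r r0 rP] := vball_eball zeta e0; apply/rP/vball_center.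
Qed.

Lemma open_eball zeta (eps : R) : 0 < eps -> open (eball zeta eps).
Proof.
move=> e0; rewrite eballE//.
pose q (z : Cd) : R := sqnorm (z - zeta).
have cq : continuous q.
  suff cq (z : Cd) : q y @[y --> z] --> q z by move=> z; exact: cq.
  rewrite /q /sqnorm.
  have cn : continuous (@normc R).
    move=> x; apply/(cvgrPdist_lt (F := nbhs x)) => e ep.
    apply/nbhs_normc; exists e => // y /= xy; apply: le_lt_trans xy.
    have := normcD (x - y) y; have := normcD (y - x) x; rewrite !subrK normcB.
    by rewrite ler_norml => ? ?; apply/andP; split; lra.
  apply: (@cvg_sum_seq R R^o Cd (nbhs z) _ _ _
    (fun i y => normc ((y - zeta) 0 i) ^+ 2)).
  move=> i.
  apply: (@continuous_comp _ _ _ (fun z : Cd => normc ((z - zeta) 0 i))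
    (fun x => x ^+ 2)).
    apply: (@continuous_comp _ _ _ (fun z : Cd => (z - zeta) 0 i) (@normc R));
      last exact: cn.
    apply: (@continuous_comp _ _ _ (fun z : Cd => z - zeta) (fun M : Cd => M 0 i)).
      by apply: (cvgB (F := nbhs z)); [exact: cvg_id|exact: cvg_cst].
    exact: coord_continuous.
  exact: exprn_continuous.
by apply: (open_comp (f := q) (D := [set x | x < eps ^+ 2])) => //;
  exact: open_lt.
Qed.

Lemma connected_eball zeta (eps : R) : 0 < eps -> connected (eball zeta eps).
Proof.
move=> e0; rewrite eballE//; apply: (@star_shaped_connected _ _ _ zeta) => z t /= zr.
move=> /andP[t0 t1]; apply: le_lt_trans zr; rewrite addrAC subrr add0r.
apply: ler_sum => i _; rewrite mxE lerXn2r ?nnegrE ?normc_ge0//.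
by rewrite normcM normc_real ger0_norm// ler_piMl ?normc_ge0.
Qed.

(** Were all points of [U] in the closure of the component inside it, it would be open and closed in
    [U], hence all of [U]. A closure point outside it cannot be in [Omega]: its own component would
    be an open set meeting the first. *)
Lemma component_touches_boundary (U Omega : set Cd) x :
  open U -> connected U -> open Omega ->
  U x -> Omega x -> ~ U `<=` Omega ->
  exists w, [/\ U w, boundary Omega w &
    closure (connected_component (U `&` Omega) x) w].
Proof.
move=> oU cU oO Ux Ox UO; set Y := connected_component _ x.
have oUO : open (U `&` Omega) by exact: openI.
have Yx : Y x by exact: connected_component_refl.
have YU : Y `<=` U `&` Omega by exact: connected_component_sub.
have [w [Uw Yw nYw]] : exists w, [/\ U w, closure Y w & ~ Y w].
  apply: contrapT => H; apply: UO; suff <- : Y = U by move=> z /YU[].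
  apply: cU; first by exists x.
    exists Y; first exact: open_component.
    by apply/seteqP; split=> [z Yz|z []//]; split => //; case: (YU _ Yz).
  exists (closure Y); first exact: closed_closure.
  apply/seteqP; split=> [z Yz|z [Uz cYz]].
    by split; [case: (YU _ Yz)|exact: subset_closure].
  by apply: contrapT => nYz; apply: H; exists z.
have nOw : ~ Omega w.
  move=> Ow; apply: nYw; have UOw : (U `&` Omega) w by [].
  have [y [Yy wy]] := Yw _ (nbhs_component oUO UOw).
  by apply: connected_component_trans Yy _; exact: connected_component_sym.
exists w; split => //; split; last by move/interior_subset.
by apply: closureS Yw => z /YU[].
Qed.

Lemma unbounded_onP (Y : set Cd) (g : Cd -> C) :
  unbounded_on Y g <-> forall K : R, exists2 z, Y z & K < normc (g z).
Proof.
split=> [ubg K|ubg [K [Kr KP]]].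
  apply: contrapT => H; apply: ubg; exists K%:C; split.
    by apply/complex_realP; exists K.
  move=> x Kx z Yz; rewrite /= normc_def; apply/ltW/(le_lt_trans _ Kx).
  rewrite lecR leNgt; apply/negP => Kg; apply: H; by exists z.
have [z Yz] := ubg (complex.Re K + 1).
rewrite ltNge => /negP; apply.
have : K < (complex.Re K + 1)%:C by rewrite -(RRe_real Kr) ltcR /= ltrDl.
by move=> /KP/(_ _ Yz); rewrite /= normc_def lecR.
Qed.

End euclidean_balls.

(** * Baire's theorem for an explicit complete metric *)

Section baire.
Variables (R : realType) (X : topologicalType) (dist : X -> X -> R).
Hypothesis mdist : is_metric dist.
Hypothesis idist : induces_topology dist.
Hypothesis cdist : dist_complete dist.

Lemma open_dist_ball x (e : R) : open [set y | dist x y < e].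
Proof.
rewrite openE => y /= xy; apply/idist; exists (e - dist x y); first by rewrite subr_gt0.
move=> z /= yz; apply: le_lt_trans (dist_triangle mdist x y z) _.
by rewrite -ltrBrDl.
Qed.

Lemma dist_refl x : dist x x = 0.
Proof. exact/(dist_eq0 mdist). Qed.

Lemma baire_metric (U : nat -> set X) :
  (forall n, open (U n)) -> (forall n, dense (U n)) -> dense (\bigcap_n U n).
Proof.
move=> oU dU O [x0 Ox0] oO.
have [e0 e00 e0O] : exists2 e : R, 0 < e & [set y | dist x0 y < e] `<=` O.
  by apply/idist; exact: open_nbhs_nbhs.
(* The closed ball of [t] lies in the open ball of [s] and in [U n]. *)
pose good (n : nat) (s t : X * R) := [/\ 0 < t.2, t.2 <= s.2 / 2 &
  forall y, dist t.1 y <= t.2 -> dist s.1 y < s.2 /\ U n y].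
have /choice[F FP] : forall ns : nat * (X * R), exists t,
    0 < ns.2.2 -> good ns.1 ns.2 t.
  (* [choice] asks for a value at nonpositive radii too; there the premise fails and any value will
     do. *)
  move=> [n [x e]] /=; have [e0'|] := ltP 0 e; last first.
    by move=> le0; exists (x, e) => /= e1; have : False by lra.
  have [|y [/= xy Uy]] := dU n [set y | dist x y < e] _ (open_dist_ball _ _).
    by exists x; rewrite /= dist_refl.
  have [r r0 rU] : exists2 r : R, 0 < r & [set z | dist y z < r] `<=`
      [set z | dist x z < e] `&` U n.
    apply/idist; apply: open_nbhs_nbhs; split=> //.
    by apply: openI; [exact: open_dist_ball|exact: oU].
  (* Halving [r] fits a closed ball into the open one found in [U n]. *)
  exists (y, Num.min (r / 2) (e / 2)) => _; split => /=.
      by rewrite lt_min !divr_gt0.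
    by rewrite ge_min lexx orbT.
  by move=> z; rewrite le_min => /andP[yz _]; apply: rU => /=; lra.
pose fix s n := if n is n'.+1 then F (n', s n') else (x0, e0).
have s0 n : 0 < (s n).2.
  elim: n => [//|n IH]; have [//] := FP (n, s n) IH.
have sP n : good n (s n) (s n.+1) := FP (n, s n) (s0 n).
have sub m n y : dist (s (m + n)%N).1 y <= (s (m + n)%N).2 -> dist (s m).1 y <= (s m).2.
  elim: n y => [|n IH] y; first by rewrite addn0.
  rewrite addnS => H; apply: IH; apply: ltW.
  by have [_ _ /(_ _ H)[]] := sP (m + n)%N.
have se n : (s n).2 <= e0 / 2 ^+ n.
  elim: n => [|n IH]; first by rewrite expr0 divr1.
  have [_ h _] := sP n; apply: (le_trans h).
  by rewrite exprSr invfM mulrA ler_wpM2r.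
have near_s m n : (m <= n)%N -> dist (s m).1 (s n).1 <= (s m).2.
  move=> mn; apply: (sub m (n - m)%N); rewrite subnKC// dist_refl.
  exact: ltW.
have small (e : R) : 0 < e -> exists N, (s N).2 < e.
  move=> ep; have nP := truncnS_gt (e0 / e); set n := (Num.trunc _).+1 in nP.
  exists n; apply: (le_lt_trans (se n)).
  rewrite ltr_pdivrMr ?exprn_gt0// -ltr_pdivrMl// mulrC (lt_trans nP)//.
  by rewrite -natrX ltr_nat ltn_expl.
have [l lP] : exists l : X, forall e : R, 0 < e ->
    exists N, forall n, (N <= n)%N -> dist (s n).1 l < e.
  apply: (@cdist (fun n => (s n).1)) => e ep.
  have [|N Ne] := small (e / 2); first by rewrite divr_gt0.
  exists N => m n Nm Nn; apply: le_lt_trans (dist_triangle mdist _ (s N).1 _) _.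
  rewrite (distC mdist _ (s N).1).
  by have := near_s _ _ Nm; have := near_s _ _ Nn; lra.
have ls n : dist (s n).1 l <= (s n).2.
  apply/ler_addgt0Pr => e ep; have [N NP] := lP _ ep.
  apply: le_trans (dist_triangle mdist _ (s (maxn n N)).1 _) _.
  by apply: lerD; [exact/near_s/leq_maxl|exact/ltW/NP/leq_maxr].
exists l; split; first by apply: e0O => /=; have [_ _ /(_ _ (ls 1%N))[]] := sP 0%N.
by move=> n _; have [_ _ /(_ _ (ls n.+1))[]] := sP n.
Qed.

End baire.

Section countable_intersections.
Variables (X : topologicalType) (J : countType).
Implicit Types U : J -> set X.

(** Numbers that code no index get [setT], which leaves the intersection unchanged and is open and
    dense. *)
Let enum_sets U n : set X := if unpickle n is Some j then U j else setT.

Let bigcap_enum U : \bigcap_j U j = \bigcap_n enum_sets U n.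
Proof.
apply/seteqP; split=> [x Ux n _|x Ux j _].
  by rewrite /enum_sets; case: unpickle => // j; exact: Ux.
by have := Ux (pickle j) I; rewrite /enum_sets pickleK.
Qed.

Lemma Gdelta_bigcap U : (forall j, open (U j)) -> Gdelta (\bigcap_j U j).
Proof.
move=> oU; exists (enum_sets U); last exact: bigcap_enum.
by move=> n; rewrite /enum_sets; case: unpickle => [j|]; [exact: oU|exact: openT].
Qed.

Lemma dense_bigcap (R : realType) (dist : X -> X -> R) U : is_metric dist ->
  induces_topology dist -> dist_complete dist ->
  (forall j, open (U j)) -> (forall j, dense (U j)) -> dense (\bigcap_j U j).
Proof.
move=> md id cd oU dU; rewrite bigcap_enum; apply: (baire_metric md id cd) => n.
  by rewrite /enum_sets; case: unpickle => [j|]; [exact: oU|exact: openT].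
rewrite /enum_sets; case: unpickle => [j|]; first exact: dU.
by move=> O [x Ox] _; exists x.
Qed.

End countable_intersections.

(** * Countably many cells along the boundary *)

Section rational_cells.
Variables (R : realType) (d : nat).
Local Notation C := (Cplx R).
Local Notation Cd := 'rV[C]_d.
Local Notation Qd := 'rV[(rat * rat)%type]_d.
Implicit Types (U Omega : set Cd) (x z w : Cd) (c : Qd * nat * Qd).

Definition rational_point (q : Qd) : Cd :=
  \row_i (ratr (q 0 i).1 +i* ratr (q 0 i).2).

Lemma rational_point_dense z (r : R) : 0 < r -> exists q, vball z r (rational_point q).
Proof.
move=> r0.
have app (a : R) : exists q : rat, `|ratr q - a| <= r / 4.
  have [|q] := @rat_in_itvoo R (a - r / 4) (a + r / 4); first by lra.
  rewrite in_itv /= => /andP[? ?]; exists q.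
  by rewrite ler_norml; apply/andP; split; lra.
have /choice[f fP] := app.
exists (\row_i (f (complex.Re (z 0 i)), f (complex.Im (z 0 i)))).
rewrite /vball /= (@le_lt_trans _ _ (r / 2))//; last by lra.
apply: vnorm_le => [|i]; first by lra.
rewrite !mxE /=; have := fP (complex.Re (z 0 i)); have := fP (complex.Im (z 0 i)).
case: (z 0 i) => a b /= h1 h2; apply: (le_trans (normc_le_ReIm _)) => /=.
by apply: (le_trans (lerD h2 h1)); lra.
Qed.

(* A triple (q, n, p) encodes the component containing p of the intersection of
   Omega with the polydisc of center q and radius 1 / (n + 1). *)
Definition cell_ball c : set Cd := vball (rational_point c.1.1) (c.1.2.+1%:R^-1).

Definition cell Omega c : set Cd :=
  connected_component (cell_ball c `&` Omega) (rational_point c.2).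

(** The first two clauses make the cell nonempty; the third then yields a boundary point in the
    polydisc, through [component_touches_boundary]. *)
Definition boundary_cell Omega c :=
  [/\ cell_ball c (rational_point c.2), Omega (rational_point c.2) &
      ~ cell_ball c `<=` Omega].

(** A small rational polydisc around a boundary point [w] adherent to the component meets the
    component in a nonempty open set, and a rational point of that set picks the cell. *)
Lemma boundary_cell_refine U Omega x : open U -> connected U -> open Omega ->
  U x -> Omega x -> ~ U `<=` Omega ->
  exists c, [/\ boundary_cell Omega c, cell_ball c `<=` U &
    cell Omega c `<=` connected_component (U `&` Omega) x].
Proof.
move=> oU cU oO Ux Ox UO.
have [w [Uw [Ow nOw] Yw]] := component_touches_boundary oU cU oO Ux Ox UO.
have [r r0 rU] := open_vball_sub oU Uw.
(* The center is chosen within [1 / (n + 1) < r / 2] of [w], so the polydisc contains [w] and lies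
   in [vball w r]. *)
have r20 : 0 < r / 2 by rewrite divr_gt0.
have [n _ /(_ n (leqnn n)) nr] := near_infty_natSinv_lt (PosNum r20).
have {}nr : n.+1%:R^-1 < r / 2 := nr.
have n0 : 0 < n.+1%:R^-1 :> R by rewrite invr_gt0.
have [q qw] := rational_point_dense w n0.
pose V := vball (rational_point q) (n.+1%:R^-1 : R).
have Vw : V w by rewrite /V /vball /= vnormB.
have VU : V `<=` U.
  move=> z Vz; apply: rU; rewrite /vball /=.
  have := vnorm_distD (rational_point q) z w.
  by move: nr qw Vz; rewrite /V /vball /=; move: (_ ^-1) => e; lra.
have oV : open V by exact: open_vball.
have [y [Yy Vy]] := Yw _ (open_nbhs_nbhs (conj oV Vw)).
have oY : open (connected_component (U `&` Omega) x).
  by apply: open_component; exact: openI.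
have [s s0 sYV] := open_vball_sub (openI oY oV) (conj Yy Vy).
have [p py] := rational_point_dense y s0.
have [Yp Vp] := sYV _ py.
exists (q, n, p); split => //.
- split => //=; first by case: (connected_component_sub Yp).
  by move/(_ _ Vw); apply: contra_not nOw => Ow'; rewrite /interior;
    exact: open_nbhs_nbhs.
- by apply: component_sub => // z [Vz Oz]; split => //; exact: VU.
Qed.

Lemma boundary_cell_boundary Omega c : open Omega -> boundary_cell Omega c ->
  exists w, [/\ cell_ball c w, boundary Omega w & closure (cell Omega c) w].
Proof.
move=> oO [Bp Op BO]; apply: component_touches_boundary => //.
  exact: open_vball.
exact: connected_vball.
Qed.

Lemma boundary_not_sub U Omega w : open Omega -> U w -> boundary Omega w ->
  ~ U `<=` Omega.
Proof.
move=> oO Uw [_ nOw] /(_ _ Uw) Ow; apply: nOw.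
exact: open_nbhs_nbhs.
Qed.

(** Counterpart of [boundary_cell_refine]: each cell contains a component for a Euclidean ball
    centered on the boundary, and each such component contains a cell. *)
Lemma boundary_cell_eball Omega c : open Omega -> boundary_cell Omega c ->
  exists zeta (eps : R) Y, [/\ boundary Omega zeta, 0 < eps,
    component_of (eball zeta eps `&` Omega) Y & Y `<=` cell Omega c].
Proof.
move=> oO bc; have [w [Bw Ow Yw]] := boundary_cell_boundary oO bc.
have [r r0 rB] := open_vball_sub (open_vball _ _) Bw.
have [y [Yy ry]] := Yw _ (open_nbhs_nbhs
  (conj (@open_eball R d w r r0) (@eball_center R d w r r0))).
exists w, r, (connected_component (eball w r `&` Omega) y); split => //.
  exists y => //; split => //.
  by case: (connected_component_sub Yy).
apply: component_sub => // z [rz Oz]; split => //.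
exact/rB/eball_vball.
Qed.

Lemma unbounded_onS (Y Z : set Cd) (g : Cd -> C) : Y `<=` Z ->
  unbounded_on Y g -> unbounded_on Z g.
Proof.
move=> YZ /unbounded_onP gY; apply/unbounded_onP => K.
by have [z Yz Kz] := gY K; exists z => //; exact: YZ.
Qed.

Lemma totally_unbounded_cells Omega (g : Cd -> C) : open Omega ->
  totally_unbounded Omega g <->
  forall c, boundary_cell Omega c -> unbounded_on (cell Omega c) g.
Proof.
move=> oO; split=> [tg c bc|cg zeta eps Y bz e0 [x [ex Ox] ->]].
  have [zeta [eps [Y [bz e0 cY Yc]]]] := boundary_cell_eball oO bc.
  exact: unbounded_onS Yc (tg _ _ _ bz e0 cY).
have nsub := boundary_not_sub oO (@eball_center R d zeta eps e0) bz.
have [c [bc _ cY]] := boundary_cell_refine (@open_eball R d zeta eps e0)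
  (@connected_eball R d zeta eps e0) oO ex Ox nsub.
exact: unbounded_onS cY (cg _ bc).
Qed.

(** The bound [M] on the extension is what provides pointwise limits, and so closedness. *)
Definition cell_extension Omega c (M : R) (f F : Cd -> C) :=
  [/\ holomorphic_on (cell_ball c) F, forall z, cell_ball c z -> normc (F z) <= M &
      {in cell Omega c, f =1 F}].

(** An extension is bounded near a boundary point adherent to [Y], and some cell lies within that
    neighbourhood; an integer bound keeps the data countable. *)
Lemma extendable_cells Omega (f : Cd -> C) : open Omega ->
  extendable Omega f <-> exists c (n : nat), boundary_cell Omega c /\
    exists F, cell_extension Omega c n%:R f F.
Proof.
move=> oO; split; last first.
  move=> [c [n [bc [F [hF _ fF]]]]]; exists (cell_ball c), F, (cell Omega c).
  have [w [Bw Ow Yw]] := boundary_cell_boundary oO bc.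
  have [Bp Op _] := bc; split => //.
      by split; [exact: open_vball|exact: connected_vball|exists w].
    by exists w.
  by exists (rational_point c.2).
move=> [U [F [Y [[oU cU _] [b [Ob Ub]] hF [x [Ux Ox] ->]] fF]]].
have [w [Uw Ow Yw]] := component_touches_boundary oU cU oO Ux Ox
  (boundary_not_sub oO Ub Ob).
have [r1 r10 r1U] := open_vball_sub oU Uw.
have [r2 r20 FM] := locally_bounded (differentiable_continuous (hF _ Uw)).
pose r := Num.min r1 r2; have r0 : 0 < r by rewrite lt_min r10.
have rU : vball w r `<=` U.
  by move=> z zw; apply: r1U; apply: (lt_le_trans zw); rewrite ge_min lexx.
have rM z : vball w r z -> normc (F z) <= normc (F w) + 1.
  by move=> zw; apply: FM; apply: (lt_le_trans zw); rewrite ge_min lexx orbT.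
have [y [Yy ry]] := Yw _ (@nbhs_vball R _ w r r0).
have Oy : Omega y by case: (connected_component_sub Yy).
have [c [bc cB cY]] := boundary_cell_refine (@open_vball R _ w r)
  (@connected_vball R _ w r) oO ry Oy
  (boundary_not_sub oO (@vball_center R _ w r r0) Ow).
exists c, (Num.trunc (normc (F w) + 1)).+1; split => //; exists F; split.
- by move=> z /cB/rU/hF.
- by move=> z /cB/rM Fz; rewrite (le_trans Fz)// ltW// truncnS_gt.
- move=> z /set_mem cz; apply: fF; rewrite inE.
  apply: component_sub Yy _ (cY _ cz) => u [ru Ou]; split => //.
  exact: rU.
Qed.

End rational_cells.

(** * Residual sets *)

Section residual_sets.
Variables (R : realType) (d : nat) (Omega : set 'rV[Cplx R]_d).
Local Notation C := (Cplx R).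
Local Notation Cd := 'rV[C]_d.
Local Notation Qd := 'rV[(rat * rat)%type]_d.
Variables (X : topologicalLmodType C) (ev : X -> Cd -> C).
Variable T : (Cd -> C) -> (Cd -> C).
Hypothesis oO : open Omega.
Hypothesis hX : holomorphic_function_space Omega ev.
Hypothesis NF : normal_family Omega ev.
Hypothesis TM : id_or_mixed_partial T.
Implicit Types (f g h : X) (c : Qd * nat * Qd).

Let NFT : normal_family Omega (fun f => T (ev f)).
Proof. exact: normal_family_mixed_partial. Qed.

Let cell_Omega c z : cell Omega c z -> Omega z.
Proof. by move/connected_component_sub => []. Qed.

(** For indices coding no boundary cell the implication gives all of [X], so the intersection can
    run over every index. *)
Definition large_on_cell (cn : (Qd * nat * Qd) * nat) : set X :=
  [set f | boundary_cell Omega cn.1 ->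
     exists2 z, cell Omega cn.1 z & cn.2%:R < normc (T (ev f) z)].

Lemma open_large_on_cell cn : open (large_on_cell cn).
Proof.
rewrite openE => f lf.
have [bc|nbc] := pselect (boundary_cell Omega cn.1); last first.
  by apply: filterS filterT => g _ bc; case: nbc.
have [z cz nz] := lf bc.
have [_ cT _] := NFT.
have e0 : 0 < normc (T (ev f) z) - cn.2%:R by rewrite subr_gt0.
have /cvgcP/(_ _ e0) := cT f _ (cell_Omega cz).
apply: filterS => g fg _; exists z => //.
have := normcD (T (ev f) z - T (ev g) z) (T (ev g) z).
by rewrite subrK; move: (cn.2%:R) fg => K; lra.
Qed.

Lemma dense_large_on_cell cn :
  (forall (zeta : Cd) (eps : R) (Y : set Cd), 0 < eps -> boundary Omega zeta ->
    component_of (Omega `&` eball zeta eps) Y ->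
    exists h : X, unbounded_on Y (T (ev h))) ->
  dense (large_on_cell cn).
Proof.
move=> hyp O [f Of] openO.
have [bc|nbc] := pselect (boundary_cell Omega cn.1); last first.
  by exists f; split => // bc; case: nbc.
have [zeta [eps [Y [bz e0 cY Yc]]]] := boundary_cell_eball oO bc.
rewrite setIC in cY; have [h uh] := hyp _ _ _ e0 bz cY.
have {}uh := unbounded_onS Yc uh.
have [uf|bf] := pselect (unbounded_on (cell Omega cn.1) (T (ev f))).
  by exists f; split => // _; move/unbounded_onP : uf; exact.
have [K fK] : exists K : R, forall z, cell Omega cn.1 z -> normc (T (ev f) z) <= K.
  apply: contrapT => H; apply: bf; apply/unbounded_onP => K.
  apply: contrapT => H'; apply: H; exists K => z cz.
  by rewrite leNgt; apply/negP => Kz; apply: H'; exists z.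
(* Continuity of the vector space operations of [X]; [C^o] is the field seen as a module over
   itself. *)
have cth : (f + t *: h) @[t --> (0 : C)] --> f + 0 *: h.
  have F0 : Filter (nbhs (0 : C^o)) by exact: nbhs_filter.
  have sc : {for (0 : C^o), continuous (fun t : C^o => t *: h)}.
    apply: (@continuous_comp C^o (C^o * X)%type X (fun t => (t, h))
      (fun z => z.1 *: z.2)); last exact: scale_continuous.
    apply: (@cvg_pair C^o C^o X (nbhs (0 : C^o)) (nbhs (0 : C^o)) (nbhs h) F0 F0 _
      id (fun=> h)); first by move=> A.
    exact: cvg_cst.
  apply: (@continuous_comp C^o (X * X)%type X (fun t => (f, t *: h))
    (fun z => z.1 + z.2)); last exact: add_continuous.
  apply: (@cvg_pair C^o X X (nbhs (0 : C^o)) (nbhs f) (nbhs ((0 : C^o) *: h))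
    F0 _ _ (fun=> f) (fun t => t *: h)); first exact: cvg_cst.
  exact: sc.
rewrite scale0r addr0 in cth.
have /nbhs_normc[r r0 rO] := cth _ (open_nbhs_nbhs (conj openO Of)).
pose t : C := (r / 2)%:C.
have nt : normc t = r / 2 by rewrite normc_real gtr0_norm// divr_gt0.
exists (f + t *: h); split.
  by apply: rO; rewrite /= sub0r normcN nt; lra.
(* Where [|T h|] exceeds this threshold, [|t * T h| > n + K], so adding [T f], bounded by [K],
   leaves more than [n]. *)
move=> _; move/unbounded_onP : uh => /(_ ((cn.2%:R + K) / (r / 2)))[z cz].
rewrite ltr_pdivrMr ?divr_gt0// -nt mulrC -normcM => hz; exists z => //.
have Oz := cell_Omega cz.
have -> : T (ev (f + t *: h)) z = T (ev f) z + t * T (ev h) z.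
  apply: (mixed_partial_linear TM oO (ev_holomorphic hX _)
    (ev_holomorphic hX f) (ev_holomorphic hX h)); last by rewrite inE.
  by move=> y Oy; rewrite (evD hX) ?(evZ hX).
have := fK _ cz; move: hz.
have := normcD (T (ev f) z + t * T (ev h) z) (- T (ev f) z).
rewrite addrAC subrr add0r normcN.
by move: (cn.2%:R) => N; lra.
Qed.

Lemma totally_unbounded_bigcap :
  [set f | totally_unbounded Omega (T (ev f))] = \bigcap_cn large_on_cell cn.
Proof.
apply/seteqP; split=> f.
  move=> /(totally_unbounded_cells _ oO) tf [c n] _ bc.
  by have /unbounded_onP := tf _ bc; exact.
move=> lf; apply/(totally_unbounded_cells _ oO) => c bc; apply/unbounded_onP => K.
have [z cz nz] := lf (c, (Num.trunc K).+1) I bc.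
by exists z => //; apply: lt_trans nz; exact: truncnS_gt.
Qed.

(** [T F] is bounded near a boundary point adherent to the cell. A smaller cell within that
    neighbourhood and within the first cell carries [T f = T F], so [T f] is bounded on it. *)
Lemma totally_unbounded_not_extendable f :
  totally_unbounded Omega (T (ev f)) -> ~ extendable Omega (ev f).
Proof.
move=> /(totally_unbounded_cells _ oO) tf /(extendable_cells _ oO).
move=> [c [n [bc [F [hF _ fF]]]]].
have [w [Bw Ow Yw]] := boundary_cell_boundary oO bc.
have oB : open (cell_ball c : set Cd) by exact: open_vball.
have hTF := holomorphic_mixed_partial TM oB hF.
have [r1 r10 TFM] := locally_bounded (differentiable_continuous (hTF _ Bw)).
have [r2 r20 r2B] := open_vball_sub oB Bw.
pose r := Num.min r1 r2; have r0 : 0 < r by rewrite lt_min r10.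
have [y [Yy ry]] := Yw _ (@nbhs_vball R _ w r r0).
have [c' [bc' c'w c'c]] := boundary_cell_refine (@open_vball R _ w r)
  (@connected_vball R _ w r) oO ry (cell_Omega Yy)
  (boundary_not_sub oO (@vball_center R _ w r r0) Ow).
have /unbounded_onP/(_ (normc (T F w) + 1))[z c'z] := tf _ bc'.
have cz : cell Omega c z.
  apply: component_sub Yy _ (c'c _ c'z) => u [ru Ou]; split => //.
  by apply: r2B; apply: (lt_le_trans ru); rewrite ge_min lexx orbT.
have zr : vball w r z by have [] := connected_component_sub (c'c _ c'z).
have oc : open (cell Omega c) by apply: open_component; exact: openI.
rewrite (mixed_partial_eq_on TM oc fF) ?inE// ltNge => /negP; apply.
by apply: TFM; apply: (lt_le_trans zr); rewrite ge_min lexx.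
Qed.

(** Here a conjunction: for indices coding no boundary cell the set is empty and its complement is
    all of [X]. *)
Definition extends_across_cell (cn : (Qd * nat * Qd) * nat) : set X :=
  [set f | boundary_cell Omega cn.1 /\
     exists F, cell_extension Omega cn.1 cn.2%:R (ev f) F].

(* In place of Montel's theorem: extensions of functions converging to f have a
   pointwise limit along an ultrafilter, and it is holomorphic. *)
Lemma closed_extends_across_cell cn : closed (extends_across_cell cn).
Proof.
move: cn => [c n] f clf; set E := extends_across_cell _ in clf.
(* As [f] is adherent to [E], the trace of its neighbourhoods on [E] is a proper filter. *)
have WF : ProperFilter (within E (nbhs f)) by exact: within_nbhs_proper.
have [U [UU WU]] := ultraFilterLemma WF.
have PU : ProperFilter U by exact: ultra_proper.
have UE : \forall g \near U, E g by apply: WU; exact: withinT.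
have [g0 Eg0] := filter_ex UE; have [bc _] := Eg0; split => //=.
have /choice[F FP] : forall g, exists F : Cd -> C,
    E g -> cell_extension Omega c n%:R (ev g) F.
  move=> g; have [[_ [F HF]]|nE] := pselect (E g); first by exists F.
  by exists (fun=> 0).
have /choice[G GP] : forall z, exists l : C,
    cell_ball c z -> F g z @[g --> U] --> l.
  move=> z; have [cz|ncz] := pselect (cell_ball c z); last by exists 0.
  have [|l Fl] := @ultra_bounded_cvg R X U (fun g => F g z) n%:R UU.
    by apply: filterS UE => g /FP[_ + _]; exact.
  by exists l.
have FM : \forall g \near U, forall y, cell_ball c y ->
    differentiable (F g) y /\ normc (F g y) <= n%:R.
  apply: filterS UE => g /FP[h1 h2 _] y cy.
  by split; [exact: h1|exact: h2].
exists G; split.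
- by move=> z cz; apply: (pointwise_limit_differentiable PU FM GP).
- by move=> z cz; apply: (pointwise_limit_bound PU FM GP).
- move=> z /set_mem cz.
  have [cB Oz] := connected_component_sub cz.
  have [_ cev _] := NF.
  (* [U] contains all neighbourhoods of [f], so [ev g z] tends to [ev f z]; uniqueness of limits
     then gives [ev f z = G z] on the cell. *)
  have evU : ev g z @[g --> U] --> ev f z.
    move=> A /(cev f _ Oz) fA; apply: WU.
    exact: (@filterS X (nbhs f) _ _ _ (fun g gA _ => gA) fA).
  have FU : F g z @[g --> U] --> ev f z.
    apply: cvg_trans evU; apply: near_eq_cvg.
    by apply: filterS UE => g /FP[_ _ gF]; apply: gF; rewrite inE.
  exact: (cvg_unique _ FU (GP _ cB)).
Qed.

Lemma non_extendable_bigcap :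
  [set f | ~ extendable Omega (ev f)] = \bigcap_cn ~` extends_across_cell cn.
Proof.
apply/seteqP; split=> f.
  move=> nf [c n] _ [bc fE]; apply: nf.
  by apply/(extendable_cells _ oO); exists c, n.
move=> nf /(extendable_cells _ oO)[c [n [bc fE]]].
exact: (nf (c, n) I).
Qed.

End residual_sets.

Theorem theorem2p8 (R : realType) (d : nat) (Omega : set 'rV[Cplx R]_d)
  (X : topologicalLmodType (Cplx R)) (ev : X -> 'rV[Cplx R]_d -> Cplx R)
  (T : ('rV[Cplx R]_d -> Cplx R) -> ('rV[Cplx R]_d -> Cplx R)) :
  domain Omega ->
  holomorphic_function_space Omega ev ->
  completely_metrizable R X ->
  cvg_uniform_on_compacts Omega ev ->
  id_or_mixed_partial T ->
  (forall (zeta : 'rV[Cplx R]_d) (eps : R) (Y : set 'rV[Cplx R]_d),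
    0 < eps -> boundary Omega zeta ->
    component_of (Omega `&` eball zeta eps) Y ->
    exists h : X, unbounded_on Y (T (ev h))) ->
  [/\ exists h : X, totally_unbounded Omega (T (ev h)),
      dense [set f : X | totally_unbounded Omega (T (ev f))] /\
      Gdelta [set f : X | totally_unbounded Omega (T (ev f))] &
      dense [set f : X | ~ extendable Omega (ev f)] /\
      Gdelta [set f : X | ~ extendable Omega (ev f)]].
Proof.
move=> [oO _ _] hX [dist [md id cd]] cX TM hyp.
have NF := normal_family_ev oO hX id cX.
have oL := open_large_on_cell oO NF TM.
have dL cn := dense_large_on_cell oO hX TM cn hyp.
have TE := totally_unbounded_bigcap ev T oO.
have NE := non_extendable_bigcap ev oO.
have dT : dense [set f : X | totally_unbounded Omega (T (ev f))].
  by rewrite TE; exact: dense_bigcap md id cd oL dL.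
split.
(* Density is applied to the whole space, nonempty because it contains 0. *)
- by have [|h [_ hT]] := dT setT _ openT; [exists 0|exists h].
- by split=> //; rewrite TE; exact: Gdelta_bigcap.
- split; last first.
    rewrite NE; apply: Gdelta_bigcap => cn; apply: closed_openC.
    exact: closed_extends_across_cell.
  (* The non-extendable functions include the dense set of those with [T f] totally unbounded. *)
  move=> O O0 oO'; have [f [Of fT]] := dT _ O0 oO'.
  exists f; split => //.
  exact: totally_unbounded_not_extendable oO TM _ fT.
Qed.
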